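(* Any $P\in\Psi^q(\mathbb{T}^n_\theta)$, $q\in\mathbb{C}$, admits a holomorphic gauging, i.e., there is a holomorphic family $P(z)$, $z\in\mathbb{C}$, in $\Psi^\bullet(\mathbb{T}^n_\theta)$ of order $z+q$ such that $P(0)=P$.
   Context: Noncommutative torus. Let $n\ge 2$ and let $\theta=(\theta_{jk})$ be a real antisymmetric $n\times n$ matrix. $C(\mathbb{T}^n_\theta)$ is the universal $C^*$-algebra (norm $\|\cdot\|$) generated by unitaries $U_1,\dots,U_n$ with $U_kU_j=e^{2i\pi\theta_{jk}}U_jU_k$. Put $U^k=U_1^{k_1}\cdots U_n^{k_n}$, $k\in\mathbb{Z}^n$. $C^\infty(\mathbb{T}^n_\theta)=\{\sum_k u_kU^k:\ (u_k)_{k\in\mathbb{Z}^n}\text{ rapidly decaying}\}$ is a Fréchet $*$-algebra with semi-norms $\|\delta^\beta u\|$, where $\delta_1,\dots,\delta_n$ are the derivations with $\delta_j(U^k)=k_jU^k$ and $\delta^\beta=\delta_1^{\beta_1}\cdots\delta_n^{\beta_n}$. Symbols and operators. $C^\infty(\mathbb{T}^n_\theta\times V)$ is the Fréchet space $C^\infty(V;C^\infty(\mathbb{T}^n_\theta))$ for $V\subseteq\mathbb{R}^n$ open. $S_q(\mathbb{T}^n_\theta\times\mathbb{R}^n)$, $q\in\mathbb{C}$: $\rho\in C^\infty(\mathbb{T}^n_\theta\times(\mathbb{R}^n\setminus0))$ with $\rho(t\xi)=t^q\rho(\xi)$, $t>0$. $S^q(\mathbb{T}^n_\theta\times\mathbb{R}^n)$: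 $\rho\in C^\infty(\mathbb{T}^n_\theta\times\mathbb{R}^n)$ for which there are $\rho_{q-j}\in S_{q-j}$, $j\ge0$, such that for all $N,\alpha,\beta$ there is $C$ with $\|\delta^\alpha\partial_\xi^\beta(\rho-\sum_{j<N}\rho_{q-j})(\xi)\|\le C|\xi|^{\Re q-N-|\beta|}$ for $|\xi|\ge1$. $P_\rho(\sum_ku_kU^k)=\sum_ku_k\rho(k)U^k$; $\Psi^q(\mathbb{T}^n_\theta)=\{P_\rho:\rho\in S^q\}$, $\Psi^\bullet(\mathbb{T}^n_\theta)=\bigcup_{q\in\mathbb{C}}\Psi^q(\mathbb{T}^n_\theta)$. Holomorphic families. A map into a topological vector space is holomorphic if its complex difference quotients converge at each point. For $\Omega\subseteq\mathbb{C}$ open, $P(z)$, $z\in\Omega$, is a holomorphic family in $\Psi^\bullet(\mathbb{T}^n_\theta)$ of order $w(z)$ if $P(z)=P_{\rho(z)}$ for all $z\in\Omega$, where: (i) $w(z)$ is holomorphic on $\Omega$ and $\rho(z)\in S^{w(z)}(\mathbb{T}^n_\theta\times\mathbb{R}^n)$ for all $z$; (ii) $\rho(z)$, $z\in\Omega$, is a holomorphic family in $C^\infty(\mathbb{T}^n_\theta\times\mathbb{R}^n)$; (iii) there are $\rho_j(z)\in S_{w(z)-j}(\mathbb{T}^n_\theta\times\mathbb{R}^n)$, $j\ge0$, such that for all $N\ge0$, compact $K\subseteq\Omega$ and multi-orders $\alpha,\beta$ there is $C$ with $\|\delta^\alpha\partial_\xi^\beta(\rho(z)-\sum_{j<N}\rho_j(z))(\xi)\|\le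 C|\xi|^{\Re w(z)-N-|\beta|}$ for all $z\in K$, $|\xi|\ge1$. *)

(* Defs.v *)
From HB Require Import structures.
From mathcomp Require Import all_boot all_order all_algebra finmap.
From mathcomp Require Import complex.
From mathcomp Require Import all_classical all_reals all_analysis.
From mathcomp Require Import summability.
Set Implicit Arguments.
Unset Strict Implicit.
Unset Printing Implicit Defensive.
Import Order.TTheory GRing.Theory Num.Theory.
Import numFieldNormedType.Exports.
Local Open Scope classical_set_scope.
Local Open Scope ring_scope.

(* R[i], declared as a numClosedFieldType so that it carries the topology of
   its modulus. *)
Definition cplx (R : realType) : numClosedFieldType := R[i].

Section ComplexNumbers.
Variable R : realType.

Definition rc (x : R) : cplx R := Complex x 0.

Definition re (z : cplx R) : R := complex.Re z.
Definition im (z : cplx R) : R := complex.Im z.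

(* Norms of complex normed modules are values (in fact nonnegative reals) in
   the field of complex numbers; this is the same number as an element of R. *)
Definition rnorm (E : normedModType (cplx R)) (x : E) : R := re `|x|.

Definition expi (t : R) : cplx R := Complex (cos t) (sin t).

(* t ^ q = exp (q * ln t) for t > 0 *)
Definition cpow (t : R) (q : cplx R) : cplx R :=
  rc (expR (re q * ln t)) * expi (im q * ln t).

End ComplexNumbers.

HB.mixin Record isCStar (K : numClosedFieldType) A
    & CompleteNormedModule K A := {
  cstar_one : A;
  cstar_mul : A -> A -> A;
  cstar_mulA : associative cstar_mul;
  cstar_mul1x : left_id cstar_one cstar_mul;
  cstar_mulx1 : right_id cstar_one cstar_mul;
  cstar_mulDl : left_distributive cstar_mul +%R;
  cstar_mulDr : right_distributive cstar_mul +%R;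
  cstar_one_neq0 : cstar_one != 0;
  cstar_scaleAl : forall (c : K) (x y : A),
    c *: cstar_mul x y = cstar_mul (c *: x) y;
  cstar_scaleAr : forall (c : K) (x y : A),
    c *: cstar_mul x y = cstar_mul x (c *: y);
  star : A -> A;
  starK : involutive star;
  starD : {morph star : x y / x + y};
  starZ : forall (c : K) (x : A), star (c *: x) = c^* *: star x;
  starM : forall x y : A, star (cstar_mul x y) = cstar_mul (star y) (star x);
  cstar_normM : forall x y : A, `|cstar_mul x y| <= `|x| * `|y|;
  cstar_norm_star : forall x : A, `|cstar_mul (star x) x| = `|x| ^+ 2
}.

#[short(type="cstarAlgType")]
HB.structure Definition CStarAlgebra (K : numClosedFieldType) :=
  {A of CompleteNormedModule K A & isCStar K A}.

(* The ring structure is attached afterwards because a join of normed modules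
   and rings would have to be declared before numDomainType. *)
Section CStarRing.
Variables (K : numClosedFieldType) (A : cstarAlgType K).

#[non_forgetful_inheritance]
HB.instance Definition _ := GRing.Zmodule_isNzRing.Build A
  (@cstar_mulA K A) (@cstar_mul1x K A) (@cstar_mulx1 K A)
  (@cstar_mulDl K A) (@cstar_mulDr K A) (@cstar_one_neq0 K A).

#[non_forgetful_inheritance]
HB.instance Definition _ :=
  GRing.Lmodule_isLalgebra.Build K A (@cstar_scaleAl K A).

#[non_forgetful_inheritance]
HB.instance Definition _ :=
  GRing.Lalgebra_isAlgebra.Build K A (@cstar_scaleAr K A).

End CStarRing.

Section CStarTheory.
Variable K : numClosedFieldType.

Definition unitary (A : cstarAlgType K) (x : A) : Prop :=
  star x * x = 1 /\ x * star x = 1.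

(* Unital *-homomorphisms; the last clause is automatic for *-homomorphisms
   between C*-algebras. *)
Definition star_hom (A B : cstarAlgType K) (f : A -> B) : Prop :=
  [/\ linear f, {morph f : x y / x * y}, f 1 = 1,
      {morph f : x / star x} & forall x, `|f x| <= `|x| ].

End CStarTheory.

(* The topology of E is the one defined by the semi-norms p i. *)
Section SeminormedSpaces.
Variables (R : realType) (E : lmodType (cplx R)) (I : Type) (p : I -> E -> R).
Local Notation C := (cplx R).

Definition seminorm_cvg (T : Type) (f : T -> E) (F : set_system T) (l : E) :
    Prop :=
  forall i, (fun t => p i (f t - l)) @ F --> (0 : R).

(* X is the underlying set of the space, as a subspace of E. *)
Definition holomorphic_on (X : set E) (Omega : set C) (f : C -> E) : Prop :=
  (forall z, Omega z -> X (f z)) /\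
  (forall z, Omega z -> exists2 l, X l &
     seminorm_cvg (fun h : C => h^-1 *: (f (z + h) - f z)) 0^' l).

End SeminormedSpaces.

#[export] Existing Instance totally_filter.

Section Torus.
Variables (R : realType) (n : nat).
Local Notation C := (cplx R).

Definition torus_rel (theta : 'M[R]_n) (A : cstarAlgType C) (U : 'I_n -> A) :
    Prop :=
  (forall j, unitary (U j)) /\
  (forall j k, U k * U j = expi (2 * pi * theta j k) *: (U j * U k)).

Definition is_nctorus (theta : 'M[R]_n) (A : cstarAlgType C) (U : 'I_n -> A) :
    Prop :=
  torus_rel theta U /\
  forall (B : cstarAlgType C) (V : 'I_n -> B), torus_rel theta V ->
    exists! f : A -> B, star_hom f /\ (forall j, f (U j) = V j).

Definition enorm (xi : 'rV[R]_n) : R := Num.sqrt (\sum_j xi 0 j ^+ 2).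

Definition latt (k : 'rV[int]_n) : 'rV[R]_n := map_mx (fun m : int => m%:~R) k.

Definition rapid (u : 'rV[int]_n -> C) : Prop :=
  forall N : nat, exists c : R,
    forall k, (1 + enorm (latt k)) ^+ N * rnorm (u k : C) <= c.

Section Smooth.
Variables (A : cstarAlgType C) (U : 'I_n -> A).

(* integer powers of a unitary, whose inverse is its adjoint *)
Definition upow (x : A) (m : int) : A :=
  match m with Posz p => x ^+ p | Negz p => star x ^+ p.+1 end.

Definition Upow (k : 'rV[int]_n) : A := \prod_(j < n) upow (U j) (k 0 j).

(* unconditional convergence of the sum over the lattice *)
Definition sums_to (x : 'rV[int]_n -> A) (a : A) : Prop :=
  partial_sum x @ totally --> a.

(* C^oo(T_theta), as a subspace of A *)
Definition cinf : {pred A} := fun a =>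
  `[< exists2 u, rapid u & sums_to (fun k => u k *: Upow k) a >].

Lemma cinf_submod_closed : submod_closed cinf.
Proof.
split.
  apply/asboolP; exists (fun=> 0) => [N|].
    by exists 0 => k; rewrite /rnorm normr0 mulr0.
  rewrite /sums_to (_ : partial_sum _ = cst 0).
    by apply: cvg_cst.
  by apply/funext => J; rewrite /partial_sum big1// => i _; rewrite scale0r.
move=> c a b /asboolP[u hu ua] /asboolP[v hv vb].
apply/asboolP; exists (fun k => c * u k + v k) => [N|].
  have [cu {}hu] := hu N; have [cv {}hv] := hv N.
  exists (rnorm (c : C) * cu + cv) => k.
  have e0 : 0 <= (1 + enorm (latt k)) ^+ N.
    by rewrite exprn_ge0// addr_ge0// sqrtr_ge0.
  apply: (@le_trans _ _ ((1 + enorm (latt k)) ^+ N *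
     (rnorm (c : C) * rnorm (u k : C) + rnorm (v k : C)))).
    rewrite ler_wpM2l// /rnorm.
    have /= := le_trans (ler_normD (c * u k) (v k)) (lexx _).
    rewrite normrM; rewrite lecE => /andP[_] /=.
    by rewrite mul0r subr0.
  rewrite mulrDr lerD// mulrCA ler_wpM2l//.
  by rewrite /rnorm; have := normr_ge0 c; rewrite lecE => /andP[].
rewrite /sums_to (_ : partial_sum _ =
  (fun J => c *: partial_sum (fun k => u k *: Upow k) J +
            partial_sum (fun k => v k *: Upow k) J)).
  by apply: cvgD => //; apply: cvgZr.
apply/funext => J; rewrite /partial_sum scaler_sumr -big_split/=.
by apply: eq_bigr => i _; rewrite scalerDl scalerA.
Qed.

HB.instance Definition _ := GRing.isSubmodClosed.Build C A cinf
  cinf_submod_closed.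

Record smooth_torus := SmoothTorus { torus_val : A; _ : torus_val \in cinf }.
HB.instance Definition _ := [isSub for torus_val].
HB.instance Definition _ := [Choice of smooth_torus by <:].
HB.instance Definition _ := [SubChoice_isSubLmodule of smooth_torus by <:].

Local Notation E := smooth_torus.

(* a = sum_k u_k U^k with (u_k) rapidly decaying; such a sequence u is
   unique when U generates the noncommutative torus. *)
Definition fourier (u : 'rV[int]_n -> C) (a : E) : Prop :=
  rapid u /\ sums_to (fun k => u k *: Upow k) (torus_val a).

(* delta_j (sum_k u_k U^k) = sum_k k_j u_k U^k *)
Definition delta (j : 'I_n) (a : E) : E :=
  xget 0 [set b | forall u, fourier u a ->
                   fourier (fun k => (k 0 j)%:~R * u k) b].

(* delta^alpha = delta_1 ^ alpha_1 ... delta_n ^ alpha_n *)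
Definition deltas (alpha : 'I_n -> nat) (a : E) : E :=
  foldr (fun j b => iter (alpha j) (delta j) b) a (enum 'I_n).

Definition torus_seminorm (alpha : 'I_n -> nat) (a : E) : R :=
  rnorm (torus_val (deltas alpha a)).

(* Maps on an open set V of R^n are represented by maps on R^n whose values
   outside V are irrelevant. *)
Local Notation symb := ('rV[R]_n -> E).

Definition has_pderiv (j : 'I_n) (f : symb) (xi : 'rV[R]_n) (l : E) : Prop :=
  seminorm_cvg torus_seminorm
    (fun h : R => rc h^-1 *: (f (xi + h *: delta_mx 0 j) - f xi)) 0^' l.

Definition pderiv (j : 'I_n) (f : symb) : symb :=
  fun xi => xget 0 [set l | has_pderiv j f xi l].

Definition pderivs (beta : 'I_n -> nat) (f : symb) : symb :=
  foldr (fun j g => iter (beta j) (pderiv j) g) f (enum 'I_n).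

(* C^oo(V; C^oo(T_theta)): all iterated partial derivatives exist on V and are
   continuous there. *)
Definition smooth_on (V : set 'rV[R]_n) (f : symb) : Prop :=
  forall (js : seq 'I_n) (xi : 'rV[R]_n), V xi ->
    let g := foldr pderiv f js in
    seminorm_cvg torus_seminorm g (nbhs xi) (g xi) /\
    (forall j, exists l, has_pderiv j g xi l).

(* The suprema are finite when f is smooth on R^n; sup of an unbounded set
   would be 0. *)
Definition symb_seminorm
    (i : {K : set 'rV[R]_n | compact K} * ('I_n -> nat) * ('I_n -> nat))
    (f : symb) : R :=
  sup [set torus_seminorm i.1.2 (pderivs i.2 f xi) | xi in sval i.1.1].

Definition homsymb (q : C) (f : symb) : Prop :=
  smooth_on [set xi | xi != 0] f /\
  (forall (t : R) (xi : 'rV[R]_n), 0 < t -> xi != 0 ->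
     f (t *: xi) = cpow t q *: f xi).

Definition remainder_bound (q : C) (N : nat) (alpha beta : 'I_n -> nat)
    (rho : symb) (rhoj : nat -> symb) (c : R) (xi : 'rV[R]_n) : Prop :=
  torus_seminorm alpha
    (pderivs beta (fun eta => rho eta - \sum_(j < N) rhoj j eta) xi)
  <= c * enorm xi `^ (re q - N%:R - (\sum_j beta j)%:R).

Definition symbol (q : C) (rho : symb) : Prop :=
  smooth_on setT rho /\
  exists rhoj : nat -> symb,
    (forall j, homsymb (q - j%:R) (rhoj j)) /\
    (forall N alpha beta, exists c, forall xi, 1 <= enorm xi ->
       remainder_bound q N alpha beta rho rhoj c xi).

(* P_rho (sum_k u_k U^k) = sum_k u_k rho(k) U^k; the sum lies in
   C^oo(T_theta) when rho is a symbol, the default 0 being irrelevant then. *)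
Definition psido (rho : symb) (a : E) : E :=
  xget 0 [set b | forall u, fourier u a ->
    sums_to (fun k => u k *: (torus_val (rho (latt k)) * Upow k))
            (torus_val b)].

Definition Psi (q : C) (P : E -> E) : Prop :=
  exists2 rho, symbol q rho & P = psido rho.

Definition holomorphic_family (Omega : set C) (w : C -> C) (P : C -> E -> E) :
    Prop :=
  open Omega /\
  exists rho : C -> symb,
    [/\ forall z, Omega z -> P z = psido (rho z),
        (forall z, Omega z -> derivable w z 1) /\
        (forall z, Omega z -> symbol (w z) (rho z)),
        holomorphic_on symb_seminorm (smooth_on setT) Omega rho &
        exists rhoj : nat -> C -> symb,
          (forall j z, Omega z -> homsymb (w z - j%:R) (rhoj j z)) /\
          (forall N K alpha beta, compact K -> K `<=` Omega ->
             exists c, forall z xi, K z -> 1 <= enorm xi ->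
               remainder_bound (w z) N alpha beta (rho z) (rhoj ^~ z) c xi)].

End Smooth.
End Torus.

(* Main.v *)
(* Write P as the operator of a symbol rho with homogeneous terms rho_j, and
   let tau(t), t >= 0, be smooth and positive with tau(t) = t for t >= 1/2.
   The gauging is given by the symbols rho(z) = tau(|xi|^2)^(z/2) rho, with
   homogeneous terms |xi|^z rho_j: for |xi|^2 > 1/2 the remainders of rho(z)
   are |xi|^z times those of rho. Every derivative of f |-> c f for a scalar
   function c below is again a combination of such multiplications, so that
   smoothness, the estimates and the convergence of the difference quotients
   all follow by induction on the list of derivatives, for all f at once.

   That the derivations delta_j are well defined and linear rests on the
   uniqueness of Fourier coefficients. By the universal property the torus
   acts on the algebra by contractions, and averaging over roots of unity in
   one coordinate cuts a finite sum of u_k U^k down to a slice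
   { k | k_j = m } without increasing its norm; hence |u_m| is at most the
   norm of any finite sum of the u_k U^k that contains the index m. *)
Require Import Defs.
From mathcomp Require Import all_boot all_order all_algebra finmap.
From mathcomp Require Import complex.
From mathcomp Require Import all_classical all_reals all_analysis.
From mathcomp Require Import summability ring lra.
Set Implicit Arguments.
Unset Strict Implicit.
Unset Printing Implicit Defensive.
Import Order.TTheory GRing.Theory Num.Theory.
Import numFieldNormedType.Exports.
Local Open Scope classical_set_scope.
Local Open Scope ring_scope.

(** The weight [|xi|^z] is singular at the origin, whereas a symbol is smooth there. Replacing
    [|xi|^2] by a positive function, instead of cutting off near 0, makes the factor exactly 1 at
    [z = 0], so the family passes through [P] itself and not only through [P] up to a smoothing
    operator. The threshold 1/2 lies below 1, so the two weights agree on a neighbourhood of every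
    point with [|xi| >= 1], and so do all derivatives there. Derivatives are picked by [xget]: each
    formula for them needs an actual limit together with uniqueness of limits. In a list of
    derivatives the last entry acts first. The Leibniz rule is applied to it, which replaces [f] by
    new functions and leaves a shorter list. Differentiating [|xi|^z] brings down factors [z], so
    the constants depend on [z] only through a bound on [|z|]; this gives uniformity on compact
    sets. Holomorphy at any [z] reduces to small exponents [h], as the increment of the family is
    [exp(h lambda) - 1] times its value at [z]. Roots of unity suffice in place of integrals over
    the torus because a finite sum involves only finitely many characters. *)

(** * Complex numbers over the reals, real-valued norms and the complex exponential *)

Section ComplexBasics.
Variable R : realType.
Local Notation C := (cplx R).

Lemma cplx_eq (z w : C) : re z = re w -> im z = im w -> z = w.
Proof. by case: z => a b; case: w => c d /= -> ->. Qed.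

Lemma reD (z w : C) : re (z + w) = re z + re w.
Proof. by case: z => a b; case: w. Qed.

Lemma imD (z w : C) : im (z + w) = im z + im w.
Proof. by case: z => a b; case: w. Qed.

Lemma reN (z : C) : re (- z) = - re z. Proof. by case: z. Qed.

Lemma imN (z : C) : im (- z) = - im z. Proof. by case: z. Qed.

Lemma reM (z w : C) : re (z * w) = re z * re w - im z * im w.
Proof. by case: z => a b; case: w. Qed.

Lemma imM (z w : C) : im (z * w) = re z * im w + im z * re w.
Proof. by case: z => a b; case: w. Qed.

Definition reimE := (reD, imD, reN, imN, reM, imM).

Lemma rcD (x y : R) : rc (x + y) = rc x + rc y.
Proof. by apply: cplx_eq; rewrite ?reimE //= addr0. Qed.

Lemma rcN (x : R) : rc (- x) = - rc x.
Proof. by apply: cplx_eq; rewrite ?reimE //= oppr0. Qed.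

Lemma rcM (x y : R) : rc (x * y) = rc x * rc y.
Proof. by apply: cplx_eq; rewrite ?reimE //= ?mulr0 ?mul0r ?addr0 ?subr0. Qed.

Lemma rc0 : rc (0 : R) = 0. Proof. by []. Qed.

Lemma rc1 : rc (1 : R) = 1. Proof. by []. Qed.

Lemma rcV (x : R) : rc x^-1 = (rc x)^-1.
Proof.
have [->|x0] := eqVneq x 0; first by rewrite !(invr0, rc0).
have rx0 : rc x != 0 by apply/eqP => -[/eqP]; rewrite (negbTE x0).
by apply: (mulIf rx0); rewrite -rcM !mulVf.
Qed.

Lemma rnormE (E : normedModType C) (x : E) : `|x| = rc (rnorm x).
Proof.
apply: cplx_eq => //=; have := normr_ge0 x.
by rewrite lecE => /andP[/eqP].
Qed.

Lemma rc_le (x y : R) : (rc x <= rc y) = (x <= y).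
Proof. exact: lecR. Qed.

Lemma rc_lt (x y : R) : (rc x < rc y) = (x < y).
Proof. exact: ltcR. Qed.

Lemma rc_inj : injective (@rc R).
Proof. by move=> x y []. Qed.

Section NormedModule.
Variable E : normedModType C.

Lemma rnorm_ge0 (x : E) : 0 <= rnorm x.
Proof. by rewrite -rc_le -rnormE rc0. Qed.

Lemma rnorm0 : rnorm (0 : E) = 0.
Proof. by rewrite /rnorm normr0. Qed.

Lemma rnorm_eq0 (x : E) : rnorm x = 0 -> x = 0.
Proof. by move=> x0; apply/normr0_eq0; rewrite rnormE x0. Qed.

Lemma rnormD (x y : E) : rnorm (x + y) <= rnorm x + rnorm y.
Proof. by rewrite -rc_le rcD -!rnormE ler_normD. Qed.

Lemma rnormN (x : E) : rnorm (- x) = rnorm x.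
Proof. by rewrite /rnorm normrN. Qed.

Lemma rnormZ (c : C) (x : E) : rnorm (c *: x) = rnorm c * rnorm x.
Proof. by apply: rc_inj; rewrite rcM -!rnormE normrZ. Qed.

Lemma rnorm_sum (I : Type) (r : seq I) (P : pred I) (F : I -> E) :
  rnorm (\sum_(i <- r | P i) F i) <= \sum_(i <- r | P i) rnorm (F i).
Proof.
elim/big_rec2: _ => [|i y x _ h]; first by rewrite rnorm0.
by rewrite (le_trans (rnormD _ _))// lerD2l.
Qed.

End NormedModule.

Lemma rnormM (c d : C) : rnorm (c * d) = rnorm c * rnorm d.
Proof. by apply: rc_inj; rewrite rcM -!rnormE normrM. Qed.

Lemma rnormV (c : C) : rnorm c^-1 = (rnorm c)^-1.
Proof. by apply: rc_inj; rewrite rcV -!rnormE normfV. Qed.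

Lemma rnorm_sqr (z : C) : rnorm z ^+ 2 = re z ^+ 2 + im z ^+ 2.
Proof.
by rewrite /rnorm normc_def /= sqr_sqrtr // addr_ge0 // sqr_ge0.
Qed.

Lemma rnorm1 : rnorm (1 : C) = 1.
Proof. by rewrite /rnorm normr1. Qed.

Lemma rnorm_rc (x : R) : rnorm (rc x) = `|x|.
Proof. by rewrite /rnorm normc_def /= expr0n addr0 sqrtr_sqr. Qed.

Lemma rnorm_le_reim (z : C) : rnorm z <= `|re z| + `|im z|.
Proof.
rewrite -(@ler_pXn2r _ 2) ?nnegrE ?rnorm_ge0 ?addr_ge0 //.
rewrite rnorm_sqr sqrrD !real_normK ?num_real //.
by rewrite lerD2r lerDl mulrn_wge0 // mulr_ge0.
Qed.

Lemma re_le_rnorm (z : C) : `|re z| <= rnorm z.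
Proof.
rewrite -(@ler_pXn2r _ 2) ?nnegrE ?rnorm_ge0 //.
by rewrite rnorm_sqr real_normK ?num_real // lerDl sqr_ge0.
Qed.

Lemma im_le_rnorm (z : C) : `|im z| <= rnorm z.
Proof.
rewrite -(@ler_pXn2r _ 2) ?nnegrE ?rnorm_ge0 //.
by rewrite rnorm_sqr real_normK ?num_real // lerDr sqr_ge0.
Qed.

Lemma expiD (s t : R) : expi (s + t) = expi s * expi t.
Proof.
apply: cplx_eq; rewrite ?reimE /= ?cosD ?sinD // addrC; congr (_ + _).
Qed.

Lemma expi0 : expi (0 : R) = 1.
Proof. by apply: cplx_eq => /=; rewrite ?cos0 ?sin0. Qed.

Lemma rnorm_expi (t : R) : rnorm (expi t) = 1.
Proof.
apply: (@pexpIrn _ 2) => //; rewrite ?nnegrE ?rnorm_ge0 //.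
by rewrite rnorm_sqr /= cos2Dsin2 expr1n.
Qed.

Lemma expiM_nat (t : R) (m : nat) : expi (m%:R * t) = expi t ^+ m.
Proof.
elim: m => [|m ih]; first by rewrite mul0r expi0.
by rewrite -natr1 mulrDl mul1r expiD ih exprSr.
Qed.

(** Both sides are inverse to [expi t]. *)
Lemma conj_expi (t : R) : (expi t)^* = expi (- t).
Proof.
have h : expi t * expi (- t) = 1 by rewrite -expiD subrr expi0.
have h' : expi t * (expi t)^* = 1.
  by rewrite -normCK rnormE rnorm_expi expr1n.
apply: (@mulfI _ (expi t)); last by rewrite h h'.
by apply/eqP => e0; move: h; rewrite e0 mul0r => /esym/eqP; rewrite oner_eq0.
Qed.

Definition cexp (z : C) : C := rc (expR (re z)) * expi (im z).

Lemma cexpD (z w : C) : cexp (z + w) = cexp z * cexp w.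
Proof. by rewrite /cexp reD imD expRD rcM expiD mulrACA. Qed.

Lemma cexp0 : cexp 0 = 1.
Proof. by rewrite /cexp /= expR0 expi0 mulr1. Qed.

Lemma rnorm_cexp (z : C) : rnorm (cexp z) = expR (re z).
Proof. by rewrite rnormM rnorm_expi mulr1 rnorm_rc ger0_norm ?expR_ge0. Qed.

Lemma cpowE (t : R) (z : C) : cpow t z = cexp (z * rc (ln t)).
Proof. by rewrite /cpow /cexp reM imM /= !mulr0 subr0 add0r. Qed.

End ComplexBasics.

(** * Norms and integer powers of unitaries in a C*-algebra *)

Section CStarNorms.
Variables (R : realType) (A : cstarAlgType (cplx R)).
Local Notation C := (cplx R).

Lemma star1 : star (1 : A) = 1.
Proof.
have h : star (star (1 : A) * 1) = star 1 * 1.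
  by have := starM (star (1 : A)) 1; rewrite starK.
by move: h; rewrite mulr1 starK => <-.
Qed.

Lemma rnorm_star_mul (x : A) : rnorm (star x * x) = rnorm x ^+ 2.
Proof.
apply: rc_inj; rewrite -rnormE expr2 rcM -!rnormE -expr2.
exact: cstar_norm_star.
Qed.

(** The C*-identity makes this norm equal to its own square, and it is nonzero since [1 != 0]. *)
Lemma rnorm_cstar1 : rnorm (1 : A) = 1.
Proof.
have := rnorm_star_mul (1 : A); rewrite star1 mulr1 expr2 => /eqP.
rewrite -subr_eq0 -{1}[rnorm (1 : A)]mulr1 -mulrBr mulf_eq0 subr_eq0.
case/orP => [/eqP/rnorm_eq0/eqP|/eqP <- //].
by rewrite oner_eq0.
Qed.

Lemma rnorm_unitary (x : A) : unitary x -> rnorm x = 1.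
Proof.
case=> h _; have := rnorm_star_mul x; rewrite h rnorm_cstar1 => /esym/eqP.
by rewrite sqrp_eq1 ?rnorm_ge0 // => /eqP.
Qed.

Lemma unitary_star (x : A) : unitary x -> unitary (star x).
Proof. by case=> h h'; split; rewrite starK. Qed.

Lemma unitaryM (x y : A) : unitary x -> unitary y -> unitary (x * y).
Proof.
have sM : star (x * y) = star y * star x by exact: starM.
case=> [x1 x2] [y1 y2]; split; rewrite sM.
  by rewrite mulrA -(mulrA (star y)) x1 mulr1.
by rewrite mulrA -(mulrA x) y2 mulr1.
Qed.

Lemma unitary1 : unitary (1 : A).
Proof. by split; rewrite star1 mulr1. Qed.

Lemma unitaryX (x : A) m : unitary x -> unitary (x ^+ m).
Proof.
by move=> hx; elim: m => [|m ih]; [exact: unitary1|rewrite exprS; exact: unitaryM].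
Qed.

Lemma unitaryZ (x : A) (t : R) : unitary x -> unitary (expi t *: x).
Proof.
have sZ : star (expi t *: x) = expi (- t) *: star x.
  by rewrite -conj_expi; exact: starZ.
case=> h h'; split; rewrite sZ -scalerAl -scalerAr scalerA -expiD.
  by rewrite addNr expi0 scale1r.
by rewrite subrr expi0 scale1r.
Qed.

Lemma unitary_upow (x : A) (m : int) : unitary x -> unitary (upow x m).
Proof.
by case: m => m hx; apply: unitaryX => //; exact: unitary_star.
Qed.

Lemma unitary_prod (I : Type) (r : seq I) (F : I -> A) :
  (forall i, unitary (F i)) -> unitary (\prod_(i <- r) F i).
Proof.
move=> h; elim/big_ind: _ => //; [exact: unitary1|exact: unitaryM].
Qed.

Lemma upowZ (x : A) (t : R) (m : int) :
  upow (expi t *: x) m = expi (t * m%:~R) *: upow x m.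
Proof.
have sZ : star (expi t *: x) = expi (- t) *: star x.
  by rewrite -conj_expi; exact: starZ.
case: m => m; rewrite /upow.
  by rewrite exprZn -expiM_nat mulrC.
rewrite sZ exprZn -expiM_nat; congr (expi _ *: _).
by rewrite NegzE mulrNz !mulrN mulrC.
Qed.

End CStarNorms.

(** * Uniqueness of Fourier coefficients through the torus action *)

Section FourierUniqueness.
Variables (R : realType) (n : nat).
Local Notation C := (cplx R).

Lemma expi_2pi_int (d : int) : expi (2 * pi * d%:~R) = 1 :> C.
Proof.
have h m : expi (2 * pi * m%:R) = 1 :> C.
  rewrite mulrC expiM_nat [expi _](_ : _ = 1) ?expr1n //.
  by apply: cplx_eq => /=; rewrite mulr_natl ?cos2pi ?sin2pi.
case: d => m; first exact: h.
by rewrite NegzE mulrNz mulrN -conj_expi h rmorph1.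
Qed.

(** By the double angle formula [cos t = 1] forces [sin (t / 2) = 0], whereas [sin] is positive
    strictly between 0 and [pi]. *)
Lemma expi_neq1 (t : R) : 0 < `|t| < 2 * pi -> expi t != 1 :> C.
Proof.
move=> t2; apply/eqP => -[c1 s1].
have : cos (t / 2 + t / 2) = 1 by rewrite -splitr.
rewrite cosD -!expr2 cos2sin2 => h.
have h0 : sin (t / 2) = 0 by apply/eqP; rewrite -sqrf_eq0; apply/eqP; lra.
have h1 : sin `|t / 2| = 0 by case: ger0P => _; rewrite ?sinN h0 ?oppr0.
have : 0 < sin `|t / 2|.
  by apply: sin_gt0_pi; rewrite normrM (@ger0_norm _ 2^-1) //; lra.
by rewrite h1 ltxx.
Qed.

(** Geometric sum of an [M]-th root of unity [w]: multiplied by [w - 1] it gives [w ^+ M - 1 = 0].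
    The bound on [d] ensures [w != 1] unless [d = 0]. *)
Lemma mean_expi (M : nat) (d : int) : (`|d| < M)%N ->
  M%:R^-1 * \sum_(a < M) expi (2 * pi / M%:R * a%:R * d%:~R) = (d == 0)%:R :> C.
Proof.
move=> dM; have M0 : (0 < M)%N by apply: leq_trans dM.
have MR0 : 0 < M%:R :> R by rewrite ltr0n.
pose w : C := expi (2 * pi / M%:R * d%:~R).
rewrite (eq_bigr (fun a : 'I_M => w ^+ a)); last first.
  by move=> a _; rewrite -expiM_nat; congr expi; ring.
have [d0|d0] := eqVneq d 0.
  rewrite (eq_bigr (fun=> 1)) => [|a _].
    by rewrite sumr_const card_ord mulVf // pnatr_eq0 -lt0n.
  by rewrite /w d0 mulr0 expi0 expr1n.
suff -> : \sum_(a < M) w ^+ a = 0 by rewrite mulr0.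
have w1 : w - 1 != 0.
  rewrite subr_eq0; apply: expi_neq1.
  have pi0 := pi_gt0 R.
  have d1 : 0 < `|d%:~R| :> R by rewrite normr_gt0 intr_eq0.
  have dM' : `|d%:~R| < M%:R :> R.
    by rewrite -intr_norm -[M%:R]/(M%:Z%:~R) ltr_int.
  have p2 : 0 < 2 * pi :> R by rewrite mulr_gt0.
  have p3 : 0 < 2 * pi / M%:R :> R by rewrite divr_gt0.
  rewrite normrM (gtr0_norm p3).
  apply/andP; split; first exact: mulr_gt0.
  by rewrite mulrAC ltr_pdivrMr // ltr_pM2l.
apply: (mulfI w1); rewrite mulr0 -subrX1 -expiM_nat.
rewrite [M%:R * _](_ : _ = 2 * pi * d%:~R) ?expi_2pi_int ?subrr //.
by field; rewrite gt_eqF.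
Qed.

Variables (A : cstarAlgType C) (theta : 'M[R]_n) (U : 'I_n -> A).
Hypothesis hU : is_nctorus theta U.

Lemma unitary_Upow k : unitary (Upow U k).
Proof.
by apply: unitary_prod => i; apply: unitary_upow; case: hU => -[].
Qed.

Lemma rnorm_Upow k : rnorm (Upow U k) = 1.
Proof. exact/rnorm_unitary/unitary_Upow. Qed.

(** Rotating the single generator [U j] by [expi s] preserves the defining relations, so the
    universal property supplies the homomorphism; it is contractive because [star_hom] includes
    this. *)
Lemma gauge (j : 'I_n) (s : R) : exists f : A -> A, star_hom f /\
  forall k, f (Upow U k) = expi (s * (k 0 j)%:~R) *: Upow U k.
Proof.
case: hU => -[uU cU] univ.
pose t (i : 'I_n) : R := if i == j then s else 0.
have hV : torus_rel theta (fun i => expi (t i) *: U i).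
  split=> [i|i k]; first exact: unitaryZ.
  by rewrite -!scalerAl -!scalerAr cU !scalerA; congr (_ *: _); ring.
have [f [[fh fU] _]] := univ A _ hV.
exists f; split=> // k.
case: fh => flin fM f1 fs _.
have fX x m : f (x ^+ m) = f x ^+ m.
  by elim: m => [|m ih]; rewrite ?f1 // !exprS fM ih.
have fpow x m : f (upow x m) = upow (f x) m.
  by case: m => m; rewrite /upow fX // fs.
rewrite /Upow; have -> : s * (k 0 j)%:~R = \sum_(i < n) t i * (k 0 i)%:~R.
  rewrite (bigD1 j) //= big1 ?addr0 /t ?eqxx // => i /negbTE ->.
  by rewrite mul0r.
elim: (index_enum _) => [|i r ih].
  by rewrite !big_nil f1 expi0 scale1r.
rewrite !big_cons fM ih fpow fU upowZ expiD.
by rewrite -scalerAl -scalerAr scalerA.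
Qed.

(** The slice is the mean of rotated copies of the full sum, weighted by characters of modulus 1;
    every rotation is a contraction, hence so is the mean. *)
Lemma rnorm_slice (r : seq 'rV[int]_n) (P : pred 'rV[int]_n) (j : 'I_n)
    (m : int) (u : 'rV[int]_n -> C) :
  rnorm (\sum_(k <- r | P k && (k 0 j == m)) u k *: Upow U k) <=
  rnorm (\sum_(k <- r | P k) u k *: Upow U k).
Proof.
(* The number of roots of unity exceeds every [|k_j - m|] that occurs, so no other slice is aliased
   onto the one at [m]. *)
pose M := (\max_(k <- r) `|(k 0 j - m)%R|%N).+1.
have MR0 : 0 < M%:R :> R by rewrite ltr0n.
have hM k : k \in r -> (`|(k 0 j - m)%R| < M)%N.
  move=> kr; rewrite ltnS.
  have := @leq_bigmax_seq _ r xpredT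
    (fun k : 'rV[int]_n => absz (k 0 j - m)%R) k kr isT.
  exact.
pose s := 2 * pi / M%:R : R.
pose f (a : nat) := projT1 (cid (gauge j (s * a%:R))).
have fP a : star_hom (f a) /\
    forall k, f a (Upow U k) = expi (s * a%:R * (k 0 j)%:~R) *: Upow U k.
  exact: (projT2 (cid (gauge j (s * a%:R)))).
have flin a : linear (f a) by case: (fP a) => -[].
have f0 a : f a 0 = 0.
  by have := flin a (-1) 0 0; rewrite scaler0 addr0 scaleN1r addNr.
set S := \sum_(k <- r | P k) _.
have -> : \sum_(k <- r | P k && (k 0 j == m)) u k *: Upow U k =
    \sum_(a < M) (M%:R^-1 * expi (- (s * a%:R * m%:~R))) *: f a S.
  have fS a : f a S =
      \sum_(k <- r | P k) (u k * expi (s * a%:R * (k 0 j)%:~R)) *: Upow U k.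
    rewrite /S; elim/big_rec2: _ => [|k x y _ <-]; first exact: f0.
    by rewrite flin (fP a).2 scalerA.
  under [RHS]eq_bigr do rewrite fS scaler_sumr.
  rewrite exchange_big /= big_mkcondr /=.
  rewrite big_seq_cond [RHS]big_seq_cond; apply: eq_bigr => k /andP[kr _].
  under eq_bigr do rewrite scalerA.
  rewrite -scaler_suml.
  rewrite (eq_bigr (fun a : 'I_M => (u k * M%:R^-1) *
      expi (2 * pi / M%:R * a%:R * (k 0 j - m)%:~R))); last first.
    move=> a _; rewrite [(k 0 j - m)%:~R]rmorphB /= mulrBr expiD -/s.
    by rewrite mulrC mulrACA -!mulrA [expi _ * expi _]mulrC; congr (_ * _).
  rewrite -mulr_sumr -mulrA mean_expi ?hM // subr_eq0.
  by case: eqP => _; rewrite ?mulr1 // mulr0 scale0r.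
apply: (le_trans (rnorm_sum _ _ _)).
apply: (@le_trans _ _ (\sum_(a < M) M%:R^-1 * rnorm S)); last first.
  by rewrite sumr_const card_ord -mulrnAl -mulr_natl mulfV ?mul1r ?gt_eqF.
apply: ler_sum => a _; rewrite rnormZ rnormM rnorm_expi mulr1.
have -> : M%:R^-1 = rc M%:R^-1 :> C.
  by rewrite rcV; congr (_^-1); elim: (M) => // b ih; rewrite -!natr1 rcD ih.
rewrite rnorm_rc ger0_norm ?invr_ge0 ?(ltW MR0) // ler_wpM2l ?invr_ge0 ?(ltW MR0) //.
by case: (fP a) => -[_ _ _ _ fn] _; rewrite -rc_le -!rnormE.
Qed.

(** Slicing in one coordinate after another leaves only the index [m], which occurs once since [r]
    is duplicate-free; [Upow U m] has norm 1. *)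
Lemma rnorm_coef_le (r : seq 'rV[int]_n) (m : 'rV[int]_n)
    (u : 'rV[int]_n -> C) : uniq r -> m \in r ->
  rnorm (u m) <= rnorm (\sum_(k <- r) u k *: Upow U k).
Proof.
move=> ur mr.
have h s : rnorm (\sum_(k <- r | all (fun j => k 0 j == m 0 j) s)
      u k *: Upow U k) <= rnorm (\sum_(k <- r) u k *: Upow U k).
  elim: s => [//|j s ih].
  under eq_bigl do rewrite /= andbC.
  exact: le_trans (rnorm_slice _ _ _ _ _) ih.
have := h (enum 'I_n); apply: le_trans.
rewrite (eq_bigl (pred1 m)) => [|k]; last first.
  apply/allP/eqP => [e|-> //]; apply/rowP => j.
  by apply/eqP/e; rewrite mem_enum.
by rewrite -big_filter filter_pred1_uniq // big_seq1 rnormZ rnorm_Upow mulr1.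
Qed.

Lemma sums_to0 (u : 'rV[int]_n -> C) :
  sums_to (fun k => u k *: Upow U k) 0 -> forall m, u m = 0.
Proof.
move=> h m; apply: rnorm_eq0; apply/eqP; rewrite eq_le rnorm_ge0 andbT.
apply/ler_addgt0Pl => e e0; rewrite addr0.
have /cvgrPdist_lt/(_ (rc e)) := h.
rewrite -rc0 rc_lt => /(_ e0)[J0 _ hJ].
(* Enlarging [J0] by [m] keeps the partial sum small while making its norm dominate [u m]. *)
have := hJ (m |` J0)%fset; rewrite /= fsubsetU1 => /(_ isT).
rewrite sub0r normrN rnormE rc_lt => /ltW; apply: le_trans.
rewrite /partial_sum -(big_seq_fsetE _ _ xpredT (fun k => u k *: Upow U k)) /=.
by apply: rnorm_coef_le; rewrite ?fset_uniq // fset1U1.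
Qed.

End FourierUniqueness.

(** * Absolute summability of rapidly decaying sequences on the lattice *)

Section Summability.
Variables (R : realType) (n : nat).
Local Notation C := (cplx R).

(* [h m = m / (1 + |m|)] is bounded, and its increments dominate
   [1 / (1 + |m|)^2], whose sums thus telescope. *)
Lemma sum_inv_sqr_le (M : nat) :
  \sum_(a < M.*2.+1) (1 + `|(a%:Z - M%:Z)%:~R|) ^- 2 <= 4 :> R.
Proof.
pose h (m : int) : R := m%:~R / (1 + `|m%:~R|).
have hb m : `|h m| <= 1.
  rewrite normrM normfV (@ger0_norm _ (1 + _)) ?addr_ge0 //.
  by rewrite ler_pdivrMr ?ltr_wpDr // mul1r lerDr.
have hstep m : (1 + `|m%:~R|) ^- 2 <= 2 * (h (m + 1) - h m) :> R.
  have key (y : R) : 0 <= y ->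
      2 / ((1 + y) * (2 + y)) = 2 * ((y + 1) / (1 + (y + 1)) - y / (1 + y)).
    by move=> y0; field; rewrite !gt_eqF //; lra.
  have bnd (y : R) : 0 <= y -> (1 + y) ^- 2 <= 2 / ((1 + y) * (2 + y)).
    move=> y0; rewrite -[_ ^- 2]mul1r ler_pdivrMr ?exprn_gt0 ?ltr_wpDr //.
    rewrite mulrAC ler_pdivlMr ?mulr_gt0 ?ltr_wpDr // mul1r expr2.
    by nra.
  have ep p : (Posz p)%:~R = p%:R :> R by [].
  have eS p : (Posz p.+1)%:~R = p%:R + 1 :> R by rewrite natr1.
  case: m => p.
    rewrite /h (_ : Posz p + 1 = Posz p.+1) ?eS ?ep; last by rewrite -addn1.
    by rewrite !ger0_norm ?addr_ge0 // -key // bnd.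
  rewrite NegzE /h.
  have -> : - (p.+1%:Z) + 1 = - p%:Z by rewrite -addn1 PoszD opprD subrK.
  rewrite !mulrNz !normrN eS ep !ger0_norm ?addr_ge0 //.
  have y0 : 0 <= p%:R :> R by rewrite ler0n.
  apply: (@le_trans _ _ (2 / ((1 + p%:R) * (2 + p%:R)))); last first.
    by rewrite key // !mulNr opprK [X in 2 * X]addrC.
  apply: le_trans (bnd _ y0).
  by rewrite lef_pV2 ?posrE ?exprn_gt0 ?ltr_wpDr //; nra.
apply: (@le_trans _ _ (\sum_(0 <= a < M.*2.+1)
    (2 * h (a.+1%:Z - M%:Z) - 2 * h (a%:Z - M%:Z)))).
  rewrite big_mkord; apply: ler_sum => a _.
  rewrite -mulrBr (_ : a.+1%:Z - _ = (a%:Z - M%:Z) + 1); first exact: hstep.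
  by rewrite -[a.+1]addn1 PoszD addrAC.
rewrite (telescope_sumr (fun a : nat => 2 * h (a%:Z - M%:Z))) // -mulrBr.
have := hb (M.*2.+1%:Z - M%:Z); have := hb (0%:Z - M%:Z).
by rewrite !ler_norml => /andP[h1 _] /andP[_ h2]; lra.
Qed.

(** All indices of [r] lie in a cube, over which the sum of products factorises into [n]
    one-dimensional sums, each at most 4. *)
Lemma sum_box_le (r : seq 'rV[int]_n) : uniq r ->
  \sum_(k <- r) \prod_(j < n) (1 + `|(k 0 j)%:~R|) ^- 2 <= 4 ^+ n :> R.
Proof.
move=> ur.
pose M := \max_(k <- r) \max_(j < n) absz (k 0%R j).
have hM k j : k \in r -> (absz (k 0%R j) <= M)%N.
  move=> kr; have h1 := @leq_bigmax _ (fun j => absz (k 0%R j)) j.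
  apply: leq_trans h1 _.
  have := @leq_bigmax_seq _ r xpredT
    (fun k : 'rV[int]_n => \max_(j < n) absz (k 0%R j)) k kr isT.
  exact.
pose psi (f : {ffun 'I_n -> 'I_M.*2.+1}) : 'rV[int]_n :=
  \row_j ((f j)%:Z - M%:Z).
have psi_inj : injective psi.
  move=> f g /rowP fg; apply/ffunP => j; have := fg j; rewrite !mxE.
  by move=> /addIr [] /val_inj.
pose G (k : 'rV[int]_n) : R := \prod_(j < n) (1 + `|(k 0 j)%:~R|) ^- 2.
have G0 k : 0 <= G k.
  by apply: prodr_ge0 => j _; rewrite invr_ge0 exprn_ge0 // addr_ge0.
pose s := [seq psi f | f <- enum {ffun 'I_n -> 'I_M.*2.+1}].
have us : uniq s by rewrite map_inj_uniq // enum_uniq.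
have rs k : k \in r -> k \in s.
  move=> kr; apply/mapP.
  (* The shift by [M] makes every entry nonnegative, so [absz] loses nothing. *)
  exists [ffun j => inord (absz (k 0 j + M%:Z)%R)]; rewrite ?mem_enum //.
  apply/rowP => j; rewrite mxE ffunE.
  have kM := hM k j kr.
  have k1 : (`|k 0 j| <= M%:Z)%R by rewrite -abszE.
  have k2 : 0 <= k 0 j + M%:Z by rewrite -lerBlDr sub0r; move: k1; rewrite ler_norml => /andP[].
  rewrite inordK; first by rewrite gez0_abs // addrK.
  rewrite ltnS -lez_nat gez0_abs // -addnn PoszD lerD2r.
  by move: k1; rewrite ler_norml => /andP[].
apply: (@le_trans _ _ (\sum_(k <- s) G k)).
  rewrite [leRHS](bigID (mem r)) /= -[leLHS]addr0 lerD ?sumr_ge0 //.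
  rewrite le_eqVlt; apply/orP; left; apply/eqP.
  rewrite -[RHS]big_filter; apply: perm_big.
  apply: uniq_perm => //; first exact: filter_uniq.
  by move=> k; rewrite mem_filter; case: (boolP (k \in r)) => // /rs ->.
rewrite big_map big_enum /=.
apply: (@le_trans _ _ (\prod_(j < n) \sum_(a < M.*2.+1)
    (1 + `|(a%:Z - M%:Z)%:~R|) ^- 2)).
  rewrite bigA_distr_bigA /=; apply: ler_sum => f _; rewrite /G.
  by under [leLHS]eq_bigr do rewrite mxE.
rewrite -[X in _ ^+ X]card_ord -prodr_const; apply: ler_prod => j _.
rewrite sum_inv_sqr_le andbT; apply: sumr_ge0 => a _.
by rewrite invr_ge0 exprn_ge0 // addr_ge0.
Qed.

Lemma entry_le_enorm (x : 'rV[R]_n) j : `|x 0 j| <= enorm x.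
Proof.
rewrite -(@ler_pXn2r _ 2) ?nnegrE ?sqrtr_ge0 //.
rewrite sqr_sqrtr ?sumr_ge0 // => [|i _]; last exact: sqr_ge0.
rewrite real_normK ?num_real // (bigD1 j) //= lerDl sumr_ge0 // => i _.
exact: sqr_ge0.
Qed.

Lemma enorm_ge0 (x : 'rV[R]_n) : 0 <= enorm x.
Proof. exact: sqrtr_ge0. Qed.

(** Decay of order [2 * n] suffices: each entry of [k] is at most its norm, so two powers of the
    decay can be spent on each coordinate. *)
Lemma rapid_sum_bounded (u : 'rV[int]_n -> C) : rapid u ->
  exists B : R, forall r : seq 'rV[int]_n, uniq r ->
    \sum_(k <- r) rnorm (u k : C) <= B.
Proof.
move=> /(_ (2 * n)%N)[c hc]; exists (`|c| * 4 ^+ n) => r ur.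
apply: (@le_trans _ _ (\sum_(k <- r)
    `|c| * \prod_(j < n) (1 + `|(k 0 j)%:~R|) ^- 2)); last first.
  by rewrite -mulr_sumr ler_wpM2l // sum_box_le.
apply: ler_sum => k _.
pose e : R := 1 + enorm (latt R k).
have e0 : 0 < e by rewrite ltr_wpDr // enorm_ge0.
apply: (@le_trans _ _ (`|c| * e ^- (2 * n))).
  rewrite ler_pdivlMr ?exprn_gt0 // mulrC.
  exact: le_trans (hc k) (ler_norm _).
rewrite ler_wpM2l // exprM -exprVn -[X in _ ^+ X <= _]card_ord -prodr_const.
apply: ler_prod => j _; rewrite invr_ge0 exprn_ge0 ?(ltW e0) //=.
have x0 : 0 < 1 + `|(k 0 j)%:~R| :> R by rewrite ltr_wpDr.
rewrite lef_pV2 ?posrE ?exprn_gt0 // ler_sqr ?nnegrE ?(ltW x0) ?(ltW e0) //.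
by rewrite lerD2l; have := entry_le_enorm (latt R k) j; rewrite mxE.
Qed.

End Summability.

(** * The derivations and semi-norms of the smooth torus *)

Section SmoothTorus.
Variables (R : realType) (n : nat).
Local Notation C := (cplx R).
Variables (A : cstarAlgType C) (theta : 'M[R]_n) (U : 'I_n -> A).
Hypothesis hU : is_nctorus theta U.
Local Notation E := (smooth_torus U).

(** The finite sums of norms have a supremum; beyond a finite set whose sum nearly attains it, what
    remains is small, and completeness gives the limit. *)
Lemma rapid_sums (u : 'rV[int]_n -> C) : rapid u ->
  exists a, sums_to (fun k => u k *: Upow U k) a.
Proof.
move=> /rapid_sum_bounded[B hB].
pose x k : A := u k *: Upow U k.
pose S : set R := [set s | exists J : {fset 'rV[int]_n},
  s = \sum_(k <- J) rnorm (x k)].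
have xu k : rnorm (x k) = rnorm (u k).
  by rewrite rnormZ (rnorm_Upow hU) mulr1.
have hS : has_sup S.
  split; first by exists (\sum_(k <- fset0) rnorm (x k)); exists fset0.
  exists B => _ [J ->]; under eq_bigr do rewrite xu.
  exact/hB/fset_uniq.
suff : cvg (partial_sum x @ totally).
  by move=> /cvg_ex[a ha]; exists a.
apply: cauchy_cvg; apply: cauchy_exP => e e0.
(* Radii are positive elements of [C], hence real. *)
have ereal : e = rc (re e).
  by apply: cplx_eq => //=; move: e0; rewrite ltcE => /andP[/eqP].
have e0' : 0 < re e by rewrite -rc_lt -ereal.
have [_ [J0 ->] hJ0] := sup_adherent e0' hS.
exists (partial_sum x J0), J0 => // J /= J0J.
rewrite -ball_normE /ball_ /= ereal distrC rnormE rc_lt.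
rewrite /partial_sum -!(big_seq_fsetE _ _ xpredT x) /=.
rewrite (big_fsetID _ (mem J0)) /=.
have -> : [fset k | k in J & k \in J0]%fset = J0.
  apply/fsetP => k; rewrite !inE /=.
  by case: (boolP (k \in J0)) => kJ; rewrite ?andbT ?andbF // (fsubsetP J0J).
rewrite addrAC subrr add0r; apply: (le_lt_trans (rnorm_sum _ _ _)).
have : \sum_(k <- J) rnorm (x k) <= sup S by apply: ub_le_sup; [case: hS|exists J].
rewrite (big_fsetID _ (mem J0)) /=.
have -> : [fset k | k in J & k \in J0]%fset = J0.
  apply/fsetP => k; rewrite !inE /=.
  by case: (boolP (k \in J0)) => kJ; rewrite ?andbT ?andbF // (fsubsetP J0J).
rewrite -lerBrDl => /le_lt_trans; apply.
by rewrite ltrBlDl -ltrBlDr.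
Qed.

Lemma fourier_ex (a : E) : exists u, fourier u a.
Proof. by case: a => a ha; case/asboolP: (ha) => u; exists u. Qed.

Lemma fourier_lin (c : C) (u v : 'rV[int]_n -> C) (a b : E) :
  fourier u a -> fourier v b ->
  fourier (fun k => c * u k + v k) (c *: a + b).
Proof.
case=> ru su [rv sv]; split=> [N|].
  have [cu hu] := ru N; have [cv hv] := rv N.
  exists (rnorm (c : C) * cu + cv) => k.
  have e0 : 0 <= (1 + enorm (latt R k)) ^+ N.
    by rewrite exprn_ge0// addr_ge0// sqrtr_ge0.
  apply: (@le_trans _ _ ((1 + enorm (latt R k)) ^+ N *
     (rnorm (c : C) * rnorm (u k : C) + rnorm (v k : C)))).
    by rewrite ler_wpM2l// -rnormM rnormD.
  by rewrite mulrDr lerD// mulrCA ler_wpM2l// rnorm_ge0.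
rewrite /sums_to (_ : partial_sum _ =
  (fun J => c *: partial_sum (fun k => u k *: Upow U k) J +
            partial_sum (fun k => v k *: Upow U k) J)).
  by apply: cvgD => //; apply: cvgZr.
apply/funext => J; rewrite /partial_sum scaler_sumr -big_split/=.
by apply: eq_bigr => i _; rewrite scalerDl scalerA.
Qed.

Lemma fourier_inj (u : 'rV[int]_n -> C) (a b : E) :
  fourier u a -> fourier u b -> a = b.
Proof.
case=> _ ua [_ ub]; apply: val_inj.
exact: (cvg_unique (@norm_hausdorff _ A) ua ub).
Qed.

Lemma fourier_unique (u v : 'rV[int]_n -> C) (a : E) :
  fourier u a -> fourier v a -> u = v.
Proof.
move=> hu hv; have [_] := fourier_lin (-1) hu hv.
rewrite scaleN1r addNr => h; apply/funext => k.
have /eqP := sums_to0 hU h k.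
by rewrite mulN1r addrC subr_eq0 => /eqP.
Qed.

Lemma rapid_delta (j : 'I_n) (u : 'rV[int]_n -> C) :
  rapid u -> rapid (fun k => (k 0 j)%:~R * u k).
Proof.
move=> hu N; have [c hc] := hu N.+1; exists c => k.
apply: le_trans (hc k); rewrite rnormM mulrA exprSr.
rewrite ler_wpM2r ?rnorm_ge0 // ler_wpM2l //.
  by rewrite exprn_ge0 // addr_ge0 // enorm_ge0.
have -> : (k 0 j)%:~R = rc (latt R k 0 j) :> C.
  rewrite mxE; have h m : m%:R = rc m%:R :> C.
    by elim: m => // m ih; rewrite -!natr1 rcD ih.
  case: (k 0 j) => m; first exact: h.
  by rewrite NegzE !mulrNz rcN; congr (- _); exact: h.
rewrite rnorm_rc; apply: le_trans (entry_le_enorm _ _) _.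
by rewrite lerDr.
Qed.

(** The set from which [delta] chooses quantifies over all coefficient sequences of [a]. As there is
    only one, a single convergent series inhabits the set and the default 0 is never taken for lack
    of a candidate. *)
Lemma delta_fourier (j : 'I_n) (u : 'rV[int]_n -> C) (a : E) :
  fourier u a -> fourier (fun k => (k 0 j)%:~R * u k) (delta j a).
Proof.
move=> ua; rewrite /delta.
set P := [set b | _]; suff : P (xget 0 P) by apply.
apply: xgetPex; have ru := rapid_delta j ua.1.
have [b hb] := rapid_sums ru.
have bc : b \in cinf U by apply/asboolP; exists (fun k : 'rV_n => (k 0 j)%:~R * u k).
by exists (SmoothTorus bc) => v va; rewrite (fourier_unique va ua); split.
Qed.

Lemma delta_lin (j : 'I_n) (c : C) (a b : E) :
  delta j (c *: a + b) = c *: delta j a + delta j b.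
Proof.
have [u ua] := fourier_ex a; have [v vb] := fourier_ex b.
have h1 := delta_fourier j (fourier_lin c ua vb).
have h2 := fourier_lin c (delta_fourier j ua) (delta_fourier j vb).
apply: (fourier_inj h1); congr (fourier _ _): h2.
by apply/funext => k; rewrite mulrDr mulrCA.
Qed.

Lemma deltas_lin (alpha : 'I_n -> nat) (c : C) (a b : E) :
  deltas alpha (c *: a + b) = c *: deltas alpha a + deltas alpha b.
Proof.
rewrite /deltas; elim: (enum 'I_n) => //= j s ->.
by elim: (alpha j) => //= m ->; rewrite delta_lin.
Qed.

Local Notation p := (@torus_seminorm R n A U).

Lemma tsemi_ge0 al (a : E) : 0 <= p al a.
Proof. exact: rnorm_ge0. Qed.

Lemma tsemiD al (a b : E) : p al (a + b) <= p al a + p al b.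
Proof.
by have := deltas_lin al 1 a b; rewrite !scale1r /p => -> /=; apply: rnormD.
Qed.

Lemma deltas0 al : deltas al (0 : E) = 0.
Proof.
by have := deltas_lin al (-1) 0 0; rewrite !scaleN1r !addNr.
Qed.

Lemma tsemiZ al (c : C) (a : E) : p al (c *: a) = rnorm c * p al a.
Proof.
have := deltas_lin al c a 0; rewrite !addr0 deltas0 addr0 /p => -> /=.
exact: rnormZ.
Qed.

(** The zero multi-order already gives the norm of [A]. *)
Lemma tsemi_sep (a : E) : (forall al, p al a = 0) -> a = 0.
Proof.
move=> /(_ (fun=> 0%N)); rewrite /p.
have -> : deltas (fun=> 0%N) a = a.
  by rewrite /deltas; elim: (enum 'I_n).
by move=> /rnorm_eq0 h; apply: val_inj.
Qed.

End SmoothTorus.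

(** * Limits in the semi-norms, partial derivatives and the Leibniz rule *)

Section PartialDerivatives.
Variables (R : realType) (n : nat).
Local Notation C := (cplx R).
Variables (A : cstarAlgType C) (theta : 'M[R]_n) (U : 'I_n -> A).
Hypothesis hU : is_nctorus theta U.
Local Notation E := (smooth_torus U).
Local Notation symb := ('rV[R]_n -> E).
Local Notation p := (@torus_seminorm R n A U).
Implicit Types (f g : symb) (V : set 'rV[R]_n) (c : 'rV[R]_n -> C).

Lemma cvg0_dom (T : Type) (F : set_system T) {FF : Filter F} (f g : T -> R) :
  (forall t, 0 <= f t <= g t) -> g @ F --> (0 : R) -> f @ F --> (0 : R).
Proof.
move=> fg g0; apply: (squeeze_cvgr (f := fun=> 0) (h := g)) => //.
  by apply: nearW.
exact: cvg_cst.
Qed.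

Lemma line_cvg (j : 'I_n) (xi : 'rV[R]_n) :
  (fun h : R => xi + h *: delta_mx 0 j) @ 0^' --> xi.
Proof.
apply: cvg_trans (_ : (fun h : R => xi + h *: delta_mx 0 j) @ 0 --> xi).
  by apply: cvg_app; exact: nbhs_dnbhs.
rewrite -[X in _ --> X]addr0 -[X in _ + X](scale0r (delta_mx 0 j)).
by apply: cvgD; [exact: cvg_cst|apply: cvgZr_tmp].
Qed.

Lemma near_line (j : 'I_n) (xi : 'rV[R]_n) (P : 'rV[R]_n -> Prop) :
  (\forall eta \near xi, P eta) ->
  \forall h \near (0 : R)^', P (xi + h *: delta_mx 0 j).
Proof. by move=> h; exact: line_cvg. Qed.

Lemma tsemi_subC al (a b : E) : p al (a - b) = p al (b - a).
Proof. by rewrite -opprB -scaleN1r (tsemiZ hU) rnormN rnorm1 mul1r. Qed.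

Lemma seminorm_cvg_unique (T : Type) (F : set_system T) {FF : ProperFilter F}
    (f : T -> E) (a b : E) :
  seminorm_cvg p f F a -> seminorm_cvg p f F b -> a = b.
Proof.
move=> fa fb; apply: subr0_eq.
apply: tsemi_sep => al.
have h : (fun=> p al (a - b)) @ F --> (0 : R).
  apply: (cvg0_dom (g := fun t => p al (f t - a) + p al (f t - b))) => [t|].
    rewrite tsemi_ge0 /= (tsemi_subC al (f t) a).
    by apply: le_trans (tsemiD hU _ _ _); rewrite addrA subrK.
  by rewrite -[X in _ --> X]addr0; apply: cvgD; [exact: fa|exact: fb].
exact: (cvg_unique (@Rhausdorff R) (cvg_cst _) h).
Qed.

Lemma seminorm_cvg_near (T : Type) (F : set_system T) {FF : Filter F}
    (f g : T -> E) (a : E) : (\forall t \near F, f t = g t) ->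
  seminorm_cvg p f F a -> seminorm_cvg p g F a.
Proof.
move=> fg fa al; apply: cvg_trans (fa al); apply: near_eq_cvg.
by apply: filterS fg => t /= ->.
Qed.

Lemma seminorm_cvg_lin (T : Type) (F : set_system T) {FF : Filter F}
    (f g : T -> E) (a b : E) (c : C) :
  seminorm_cvg p f F a -> seminorm_cvg p g F b ->
  seminorm_cvg p (fun t => c *: f t + g t) F (c *: a + b).
Proof.
move=> fa gb al.
apply: (cvg0_dom
  (g := fun t => rnorm c * p al (f t - a) + p al (g t - b))) => [t|].
  rewrite tsemi_ge0 /= -(tsemiZ hU) opprD addrACA -scalerBr.
  exact: (tsemiD hU).
rewrite -[X in _ --> X]addr0 -[X in X + _](mulr0 (rnorm c)).
by apply: cvgD; [apply: cvgMl_tmp; exact: fa|exact: gb].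
Qed.

(** Continuity and differentiability of scalar coefficients are phrased as real limits equal to 0,
    like [seminorm_cvg], so that product estimates become squeezes between real functions. *)
Definition scont c (xi : 'rV[R]_n) : Prop :=
  (fun eta => rnorm (c eta - c xi)) @ xi --> (0 : R).

Definition sderiv (j : 'I_n) c (xi : 'rV[R]_n) (l : C) : Prop :=
  (fun h : R => rnorm (rc h^-1 * (c (xi + h *: delta_mx 0 j) - c xi) - l))
    @ 0^' --> (0 : R).

Definition econt f (xi : 'rV[R]_n) : Prop := seminorm_cvg p f (nbhs xi) (f xi).

Lemma has_pderiv_unique j f xi l l' :
  has_pderiv j f xi l -> has_pderiv j f xi l' -> l = l'.
Proof. exact: seminorm_cvg_unique. Qed.

Lemma pderivE j f xi l : has_pderiv j f xi l -> pderiv j f xi = l.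
Proof.
move=> h; rewrite /pderiv; apply: (has_pderiv_unique _ h).
set P := [set l | _]; suff : P (xget 0 P) by [].
by apply: xgetPex; exists l.
Qed.

Lemma has_pderiv_near j f g xi l : (\forall eta \near xi, f eta = g eta) ->
  has_pderiv j f xi l -> has_pderiv j g xi l.
Proof.
move=> fg; apply: seminorm_cvg_near.
by apply: filterS (near_line j fg) => h ->; rewrite (nbhs_singleton fg).
Qed.

Lemma pderiv_near j f g xi : (\forall eta \near xi, f eta = g eta) ->
  pderiv j f xi = pderiv j g xi.
Proof.
move=> fg; rewrite /pderiv; congr (xget _ _); apply/seteqP; split=> l /=.
  exact: has_pderiv_near.
by apply: has_pderiv_near; apply: filterS fg => eta ->.
Qed.

Lemma econt_near f g xi : (\forall eta \near xi, f eta = g eta) ->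
  econt f xi -> econt g xi.
Proof.
move=> fg; rewrite /econt -(nbhs_singleton fg); exact: seminorm_cvg_near.
Qed.

Lemma has_pderiv_lin j f g xi a b (c : C) :
  has_pderiv j f xi a -> has_pderiv j g xi b ->
  has_pderiv j (fun eta => c *: f eta + g eta) xi (c *: a + b).
Proof.
move=> fa gb; apply: seminorm_cvg_near (seminorm_cvg_lin c fa gb).
apply: nearW => h; rewrite scalerA mulrC -scalerA -scalerDr.
by congr (_ *: _); rewrite scalerBr opprD addrACA.
Qed.

Lemma econt_scale c f xi : scont c xi -> econt f xi ->
  econt (fun eta => c eta *: f eta) xi.
Proof.
move=> cc fc al.
apply: (cvg0_dom (g := fun eta => rnorm (c eta - c xi) * p al (f eta - f xi) +
  (rnorm (c eta - c xi) * p al (f xi) + rnorm (c xi) * p al (f eta - f xi)))).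
  move=> eta; rewrite tsemi_ge0 /= -!(tsemiZ hU).
  have -> : c eta *: f eta - c xi *: f xi = (c eta - c xi) *: (f eta - f xi) +
      ((c eta - c xi) *: f xi + c xi *: (f eta - f xi)).
    rewrite addrA -scalerDr subrK -[in RHS](subrK (c xi) (c eta)) addrK.
    by rewrite scalerBl scalerBr addrA subrK.
  by rewrite (le_trans (tsemiD hU _ _ _)) // lerD2l (tsemiD hU).
rewrite [X in _ --> X](_ : 0 =
    0 * 0 + (0 * p al (f xi) + rnorm (c xi) * 0)); last first.
  by rewrite !(mulr0, mul0r) !addr0.
apply: cvgD; first exact: (cvgM cc (fc al)).
by apply: cvgD; [exact: (cvgMr_tmp cc)|apply: cvgMl_tmp; exact: fc].
Qed.

(** Error of the difference quotient of a product, with [t] the inverse increment and [l], [m] the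
    derivatives of the factors. Every summand on the right contains a factor that tends to 0. *)
Lemma leibniz_quotient (t a b l : C) (x y m : E) :
  t *: (a *: x - b *: y) - (l *: y + b *: m) =
  (t * (a - b) - l) *: (x - y) + ((t * (a - b) - l) *: y +
    (l *: (x - y) + b *: (t *: (x - y) - m))).
Proof.
rewrite [RHS]addrA -scalerDr subrK [RHS]addrA (scalerBr l) addrA.
rewrite -scalerDl subrK (scalerBr b) (scalerA b) (mulrC b) -!scalerA.
rewrite opprD [RHS]addrACA; congr (_ + _).
by rewrite -scalerDr; congr (_ *: _); rewrite scalerBl scalerBr addrA subrK.
Qed.

Lemma has_pderiv_scale j c f xi (c' : C) (f' : E) :
  econt f xi -> sderiv j c xi c' -> has_pderiv j f xi f' ->
  has_pderiv j (fun eta => c eta *: f eta) xi (c' *: f xi + c xi *: f').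
Proof.
move=> fc hc hf al.
pose e (h : R) := xi + h *: delta_mx 0 j.
pose D (h : R) := rnorm (rc h^-1 * (c (e h) - c xi) - c').
pose F (h : R) := p al (f (e h) - f xi).
pose G (h : R) := p al (rc h^-1 *: (f (e h) - f xi) - f').
have F0 : F @ 0^' --> (0 : R).
  by move=> B hB; exact: (@line_cvg j xi _ (fc al B hB)).
apply: (cvg0_dom (g := fun h => D h * F h + (D h * p al (f xi) +
    (rnorm c' * F h + rnorm (c xi) * G h)))).
  move=> h; rewrite tsemi_ge0 /= -/(e h) /D /F /G -!(tsemiZ hU).
  rewrite leibniz_quotient.
  by do 3 rewrite (le_trans (tsemiD hU _ _ _)) ?lerD2l //.
rewrite [X in _ --> X](_ : 0 =
    0 * 0 + (0 * p al (f xi) + (rnorm c' * 0 + rnorm (c xi) * 0))); last first.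
  by rewrite !(mulr0, mul0r) !addr0.
apply: cvgD; first exact: (cvgM hc F0).
apply: cvgD; first exact: (cvgMr_tmp hc).
by apply: cvgD; apply: cvgMl_tmp; [exact: F0|exact: hf].
Qed.

End PartialDerivatives.

(** * Smooth functions on an open set and the scalar functions that multiply them *)

Section Multipliers.
Variables (R : realType) (n : nat).
Local Notation C := (cplx R).
Variables (A : cstarAlgType C) (theta : 'M[R]_n) (U : 'I_n -> A).
Hypothesis hU : is_nctorus theta U.
Local Notation E := (smooth_torus U).
Local Notation symb := ('rV[R]_n -> E).
Local Notation p := (@torus_seminorm R n A U).
Implicit Types (f g : symb) (c : 'rV[R]_n -> C).
Variable V : set 'rV[R]_n.
Hypothesis oV : open V.

Lemma open_near (P : 'rV[R]_n -> Prop) xi : V xi -> (forall eta, V eta -> P eta) ->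
  \forall eta \near xi, P eta.
Proof. by move=> Vxi VP; apply: filterS VP _; exact: open_nbhs_nbhs. Qed.

Lemma pderivs_list_ext f g (js : seq 'I_n) xi :
  (forall eta, V eta -> f eta = g eta) -> V xi ->
  foldr (@pderiv R n A U) f js xi = foldr (@pderiv R n A U) g js xi.
Proof.
move=> fg; elim: js xi => [|j js ih] xi Vxi /=; first exact: fg.
by apply: pderiv_near; apply: open_near.
Qed.

(* [d] bounds the number of derivatives from above strictly, so that nothing
   is required for [d = 0]. *)
Definition nsmooth (d : nat) f : Prop := forall (js : seq 'I_n) xi,
  (size js < d)%N -> V xi ->
  econt (foldr (@pderiv R n A U) f js) xi /\
  forall j, exists l, has_pderiv j (foldr (@pderiv R n A U) f js) xi l.

Lemma smooth_onP f : smooth_on V f <-> forall d, nsmooth d f.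
Proof.
split=> [h d js xi _ Vxi|h js xi Vxi]; first exact: h.
exact: (h (size js).+1).
Qed.

Lemma nsmooth_ext d f g : (forall eta, V eta -> f eta = g eta) ->
  nsmooth d f -> nsmooth d g.
Proof.
move=> fg hf js xi sjs Vxi; have [h1 h2] := hf js xi sjs Vxi.
have near_fg : \forall eta \near xi, foldr (@pderiv R n A U) f js eta =
                          foldr (@pderiv R n A U) g js eta.
  by apply: open_near => // eta; apply: pderivs_list_ext.
split=> [|j]; first exact: econt_near h1.
by have [l hl] := h2 j; exists l; exact: has_pderiv_near hl.
Qed.

Lemma nsmoothW d d' f : (d <= d')%N -> nsmooth d' f -> nsmooth d f.
Proof. by move=> dd h js xi js1; apply: h; exact: leq_trans js1 dd. Qed.

Lemma nsmooth_pderiv d j f : nsmooth d.+1 f -> nsmooth d (pderiv j f).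
Proof.
move=> h js xi sjs; have := h (rcons js j) xi.
by rewrite foldr_rcons size_rcons ltnS; apply.
Qed.

Lemma nsmooth_has_pderiv d j f xi : nsmooth d.+1 f -> V xi ->
  has_pderiv j f xi (pderiv j f xi).
Proof.
move=> h Vxi; have [_ /(_ j)[l hl]] := h [::] xi isT Vxi.
by rewrite (pderivE hU hl).
Qed.

Lemma nsmooth_econt d f xi : nsmooth d.+1 f -> V xi -> econt f xi.
Proof. by move=> h Vxi; case: (h [::] xi isT Vxi). Qed.

(** The innermost derivative of a nonempty list is its last entry; replacing it by the explicit [f']
    leaves a list shorter by one. *)
Lemma nsmoothS d f (f' : 'I_n -> symb) :
  (forall xi, V xi -> econt f xi) ->
  (forall j xi, V xi -> has_pderiv j f xi (f' j xi)) ->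
  (forall j, nsmooth d (f' j)) -> nsmooth d.+1 f.
Proof.
move=> fc fd fs; case/lastP => [|js j] xi; last first.
  rewrite size_rcons foldr_rcons ltnS => sjs Vxi.
  apply: (nsmooth_ext _ (fs j)) => // eta Veta.
  by rewrite (pderivE hU (fd j _ Veta)).
move=> _ Vxi; split=> [|j]; first exact: fc.
by exists (f' j xi); exact: fd.
Qed.

Lemma econt_lin (a : C) f g xi : econt f xi -> econt g xi ->
  econt (fun eta => a *: f eta + g eta) xi.
Proof. exact: (seminorm_cvg_lin hU). Qed.

Lemma nsmooth_lin d (a : C) f g : nsmooth d f -> nsmooth d g ->
  nsmooth d (fun eta => a *: f eta + g eta).
Proof.
elim: d f g => [//|d ih] f g hf hg.
apply: (nsmoothS (f' := fun j eta => a *: pderiv j f eta + pderiv j g eta)).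
- by move=> xi Vxi; apply: econt_lin; [exact: nsmooth_econt hf _|
    exact: nsmooth_econt hg _].
- by move=> j xi Vxi; apply: (has_pderiv_lin hU);
    [exact: nsmooth_has_pderiv hf _|exact: nsmooth_has_pderiv hg _].
- by move=> j; apply: ih; exact: nsmooth_pderiv.
Qed.

(** Where a limit does not exist [pderiv] is 0, so linearity is derived from differentiability of
    both functions along the list. *)
Lemma pderivs_list_lin (a : C) f g (js : seq 'I_n) xi :
  nsmooth (size js) f -> nsmooth (size js) g -> V xi ->
  foldr (@pderiv R n A U) (fun eta => a *: f eta + g eta) js xi =
  a *: foldr (@pderiv R n A U) f js xi + foldr (@pderiv R n A U) g js xi.
Proof.
elim: js xi => [//|j js ih] xi /= hf hg Vxi.
have sub h : nsmooth (size js).+1 h -> nsmooth (size js) h by exact: nsmoothW.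
apply: (pderivE hU).
apply: (has_pderiv_near (f := fun eta =>
    a *: foldr (@pderiv R n A U) f js eta + foldr (@pderiv R n A U) g js eta)).
  by apply: open_near => // eta Veta; rewrite ih //; exact: sub.
apply: (has_pderiv_lin hU).
  have [_ /(_ j)[l hl]] := hf js xi (ltnSn _) Vxi.
  by rewrite (pderivE hU hl).
have [_ /(_ j)[l hl]] := hg js xi (ltnSn _) Vxi.
by rewrite (pderivE hU hl).
Qed.

(* Stands for "[c] is smooth": closure under products is then composition,
   and no calculus of scalar-valued functions is needed. *)
Definition mult (d : nat) c : Prop :=
  forall f, nsmooth d f -> nsmooth d (fun eta => c eta *: f eta).

Lemma mult_ext d c c' : (forall eta, V eta -> c eta = c' eta) ->
  mult d c -> mult d c'.
Proof.
by move=> cc hc f hf; apply: nsmooth_ext (hc f hf) => eta Veta; rewrite cc.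
Qed.

Lemma multM d c c' : mult d c -> mult d c' -> mult d (fun eta => c eta * c' eta).
Proof.
move=> hc hc' f hf; apply: nsmooth_ext (hc _ (hc' f hf)) => eta _.
by rewrite scalerA.
Qed.

Lemma mult_cst d (a : C) : mult d (fun=> a).
Proof.
(* The zero function is smooth as the combination [-1 *: f + f]. *)
move=> f hf; have h0 : nsmooth d (fun=> 0).
  have := nsmooth_lin (-1) hf hf; apply: nsmooth_ext => eta _.
  by rewrite scaleN1r addNr.
have := nsmooth_lin a hf h0; apply: nsmooth_ext => eta _.
by rewrite addr0.
Qed.

Lemma multD d c c' : mult d c -> mult d c' -> mult d (fun eta => c eta + c' eta).
Proof.
move=> hc hc' f hf; apply: nsmooth_ext (nsmooth_lin 1 (hc f hf) (hc' f hf)).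
by move=> eta _; rewrite scale1r scalerDl.
Qed.

(** Leibniz rule as an induction step: [c] and its derivatives are required only at level [d]. A
    function whose derivatives involve the function itself, such as an exponential, can therefore be
    treated by induction on [d]. *)
Lemma multS d c (c' : 'I_n -> 'rV[R]_n -> C) :
  (forall xi, V xi -> scont c xi) ->
  (forall j xi, V xi -> sderiv j c xi (c' j xi)) ->
  mult d c -> (forall j, mult d (c' j)) -> mult d.+1 c.
Proof.
move=> cc cd hc hc' f hf.
apply: (nsmoothS (f' := fun j eta => c' j eta *: f eta + c eta *: pderiv j f eta)).
- move=> xi Vxi; apply: (econt_scale hU); first exact: cc.
  exact: nsmooth_econt hf _.
- move=> j xi Vxi; apply: (has_pderiv_scale hU); [|exact: cd|].
    exact: nsmooth_econt hf _.
  exact: nsmooth_has_pderiv hf _.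
move=> j; have hf' : nsmooth d f by apply: nsmoothW hf.
apply: nsmooth_ext (nsmooth_lin 1 (hc' j f hf') (hc _ (nsmooth_pderiv j hf))).
by move=> eta _; rewrite scale1r.
Qed.

Lemma smooth_on_mult c f : (forall d, mult d c) -> smooth_on V f ->
  smooth_on V (fun eta => c eta *: f eta).
Proof. by move=> hc /smooth_onP hf; apply/smooth_onP => d; exact: hc. Qed.

Lemma smooth_on_lin (a : C) f g : smooth_on V f -> smooth_on V g ->
  smooth_on V (fun eta => a *: f eta + g eta).
Proof.
by move=> /smooth_onP hf /smooth_onP hg; apply/smooth_onP => d; exact: nsmooth_lin.
Qed.

Lemma smooth_on_pderiv j f : smooth_on V f -> smooth_on V (pderiv j f).
Proof.
by move=> /smooth_onP hf; apply/smooth_onP => d; exact: nsmooth_pderiv.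
Qed.

Lemma smooth_on_ext f g : (forall eta, V eta -> f eta = g eta) ->
  smooth_on V f -> smooth_on V g.
Proof.
by move=> fg /smooth_onP hf; apply/smooth_onP => d; exact: nsmooth_ext (hf d).
Qed.

Lemma smooth_on_list js f : smooth_on V f ->
  smooth_on V (foldr (@pderiv R n A U) f js).
Proof. by move=> hf; elim: js => //= j js; exact: smooth_on_pderiv. Qed.

Lemma pderiv_scale j c f xi (c' : C) : smooth_on V f -> V xi ->
  sderiv j c xi c' ->
  pderiv j (fun eta => c eta *: f eta) xi = c' *: f xi + c xi *: pderiv j f xi.
Proof.
move=> /smooth_onP hf Vxi cd; apply: (pderivE hU).
apply: (has_pderiv_scale hU) => //; first exact: nsmooth_econt (hf 1%N) _.
exact: nsmooth_has_pderiv (hf 1%N) _.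
Qed.

Lemma pderivs_list_linS (a : C) f g (js : seq 'I_n) xi :
  smooth_on V f -> smooth_on V g -> V xi ->
  foldr (@pderiv R n A U) (fun eta => a *: f eta + g eta) js xi =
  a *: foldr (@pderiv R n A U) f js xi + foldr (@pderiv R n A U) g js xi.
Proof. by move=> /smooth_onP hf /smooth_onP hg; exact: pderivs_list_lin. Qed.

End Multipliers.

(** * Differentiating functions of the squared norm and coordinates *)

Section RadialMultipliers.
Variables (R : realType) (n : nat).
Local Notation C := (cplx R).
Implicit Types (F : R -> C) (xi : 'rV[R]_n).

Lemma cvg_dist0 (T : Type) (F : set_system T) {FF : Filter F} (f : T -> R)
    (a : R) : f @ F --> a -> (fun t => `|f t - a|) @ F --> (0 : R).
Proof.
move=> fa; rewrite -[X in _ --> X](normr0 R) -(subrr a).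
by apply: cvg_norm; apply: cvgB fa (cvg_cst _).
Qed.

(** Radial functions are expressed in [|xi|^2] and not in [|xi|], since the former is a polynomial
    on every coordinate line, also through the origin. *)
Definition ssq xi : R := \sum_j xi 0 j ^+ 2.

Lemma ssq_ge0 xi : 0 <= ssq xi.
Proof. by apply: sumr_ge0 => j _; exact: sqr_ge0. Qed.

Lemma ssq_gt0 xi : xi != 0 -> 0 < ssq xi.
Proof.
move=> x0; rewrite lt_def ssq_ge0 andbT; apply: contra x0.
rewrite psumr_eq0 => [/allP h|j _]; last exact: sqr_ge0.
apply/eqP/rowP => j; rewrite mxE; apply/eqP; rewrite -sqrf_eq0.
by apply: h; rewrite mem_index_enum.
Qed.

Lemma ssq_line (j : 'I_n) xi (h : R) :
  ssq (xi + h *: delta_mx 0 j) = ssq xi + h * (2 * xi 0 j) + h ^+ 2.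
Proof.
rewrite /ssq (bigD1 j) //= [in RHS](bigD1 j) //= !mxE !eqxx /= mulr1.
rewrite (eq_bigr (fun i => xi 0 i ^+ 2)) => [|i ij]; first by ring.
by rewrite !mxE /= (negbTE ij) mulr0 addr0.
Qed.

Lemma ssq_continuous xi : ssq eta @[eta --> xi] --> ssq xi.
Proof.
have h (s : seq 'I_n) : (fun eta : 'rV[R]_n => \sum_(j <- s) eta 0 j ^+ 2) @ xi -->
    \sum_(j <- s) xi 0 j ^+ 2.
  elim: s => [|j s ih].
    have -> : (fun eta : 'rV[R]_n => \sum_(j <- [::]) eta 0 j ^+ 2) = cst 0.
      by apply/funext => eta; rewrite big_nil.
    by rewrite big_nil; apply: cvg_cst; exact: nbhs_filter.
  have -> : (fun eta : 'rV[R]_n => \sum_(i <- j :: s) eta 0 i ^+ 2) =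
      (fun eta => eta 0 j * eta 0 j + \sum_(j <- s) eta 0 j ^+ 2).
    by apply/funext => eta; rewrite big_cons expr2.
  rewrite big_cons expr2; apply: cvgD ih.
  by apply: cvgM; exact: coord_continuous.
exact: h.
Qed.

Definition rder F (t : R) (l : C) : Prop :=
  is_derive t 1 (fun x => re (F x)) (re l) /\
  is_derive t 1 (fun x => im (F x)) (im l).

(** Chain rule along a coordinate line, where [ssq] is a quadratic polynomial in the increment with
    derivative [2 * xi 0 j] at 0. *)
Lemma is_derive_line_quotient (g : R -> R) (j : 'I_n) xi (l : R) :
  is_derive (ssq xi) 1 g l ->
  (fun h : R => h^-1 * (g (ssq (xi + h *: delta_mx 0 j)) - g (ssq xi))) @ 0^'
    --> 2 * xi 0 j * l.
Proof.
move=> hg.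
pose phi (h : R) := ssq xi + h * (2 * xi 0 j) + h ^+ 2.
have phi0 : phi 0 = ssq xi by rewrite /phi mul0r expr0n /= !addr0.
have dphi : is_derive (0 : R) 1 phi (2 * xi 0 j).
  apply: is_derive_eq.
  by rewrite /GRing.scale /= !(mul0r, mulr0, add0r, addr0, mul1r, mulr1).
have dg : is_derive (phi 0) 1 g l by rewrite phi0.
have [d1 d2] := is_derive1_comp (f := g) (g := phi) (x := 0).
have h0 : 'D_1 (g \o phi) 0 = 2 * xi 0 j * l by rewrite d2 mulrC.
rewrite -h0; apply: cvg_trans d1; apply: near_eq_cvg; apply: nearW => h /=.
by rewrite ssq_line /= -/(phi h) phi0 addr0 -[h *: 1]/(h * 1) mulr1.
Qed.

Lemma sderiv_radial (j : 'I_n) F xi (l : C) : rder F (ssq xi) l ->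
  sderiv j (fun eta => F (ssq eta)) xi (rc (2 * xi 0 j) * l).
Proof.
case=> [d1 d2].
have h1 := is_derive_line_quotient (j := j) d1.
have h2 := is_derive_line_quotient (j := j) d2.
pose e (h : R) := ssq (xi + h *: delta_mx 0 j).
pose g (h : R) :=
  `|h^-1 * (re (F (e h)) - re (F (ssq xi))) - 2 * xi 0 j * re l| +
  `|h^-1 * (im (F (e h)) - im (F (ssq xi))) - 2 * xi 0 j * im l|.
apply: (cvg0_dom (g := g)) => [h|].
  rewrite rnorm_ge0 /=; apply: le_trans (rnorm_le_reim _) _.
  by rewrite !reimE /= !(mul0r, subr0, addr0).
rewrite -[X in _ --> X](addr0 0); apply: cvgD; apply: cvg_dist0.
  exact: h1.
exact: h2.
Qed.

Lemma scont_radial F xi (l : C) : rder F (ssq xi) l ->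
  scont (fun eta => F (ssq eta)) xi.
Proof.
have cont (g : R -> R) m : is_derive (ssq xi) 1 g m ->
    (fun eta => `|g (ssq eta) - g (ssq xi)|) @ xi --> (0 : R).
  move=> [/derivable1_diffP/differentiable_continuous gc _].
  apply: (@cvg_dist0 _ _ (nbhs_filter xi)) => B hB; exact: (ssq_continuous (gc B hB)).
case=> [/cont c1 /cont c2].
pose g eta := `|re (F (ssq eta)) - re (F (ssq xi))| +
  `|im (F (ssq eta)) - im (F (ssq xi))|.
apply: (cvg0_dom (FF := nbhs_filter xi) (g := g)) => [eta|].
  by rewrite rnorm_ge0 /= (le_trans (rnorm_le_reim _)) // !reimE.
by rewrite -[X in _ --> X](addr0 0); apply: cvgD; [exact: c1|exact: c2].
Qed.

Lemma natr_rc (m : nat) : m%:R = rc m%:R :> C.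
Proof. by elim: m => // m ih; rewrite -!natr1 rcD ih. Qed.

Lemma sderiv_coord (i j : 'I_n) xi :
  sderiv j (fun eta => rc (eta 0 i)) xi (i == j)%:R.
Proof.
rewrite /sderiv; set q := (fun h : R => _).
apply: (cvg_trans _ (_ : cst (0 : R) @ 0^' --> (0 : R))); last exact: cvg_cst.
apply: near_eq_cvg; near=> h; rewrite /q /=.
have h0 : h != 0 by near: h; exact: nbhs_dnbhs_neq.
rewrite -rcN -rcD -rcM natr_rc -rcN -rcD !mxE /= eq_sym.
rewrite [xi 0 i + _]addrC addrK mulKf // subrr; exact/esym/rnorm0.
Unshelve. all: by end_near.
Qed.

Lemma scont_coord (i : 'I_n) xi : scont (fun eta => rc (eta 0 i)) xi.
Proof.
apply: (cvg0_dom (FF := nbhs_filter xi) (g := fun eta : 'rV[R]_n => `|eta 0 i - xi 0 i|)) => [eta|].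
  by rewrite rnorm_ge0 /= -rcN -rcD rnorm_rc.
by apply: (@cvg_dist0 _ _ (nbhs_filter xi)); exact: coord_continuous.
Qed.

End RadialMultipliers.

(** * A smooth function vanishing on the negative half-line *)

Section FlatFunction.
Variable R : realType.

(** The classical [exp(-1/x)], with an extra negative power of [x] that makes the family closed
    under differentiation up to linear combinations. *)
Definition flat (k : nat) (x : R) : R :=
  if 0 < x then x ^- k * expR (- x^-1) else 0.

(** For [m > 0], raise [y / m <= exp(y / m)] to the power [m]. *)
Lemma expR_powM_le (m : nat) (y : R) : 0 <= y ->
  y ^+ m * expR (- y) <= m%:R ^+ m.
Proof.
move=> y0; case: m => [|m].
  by rewrite !expr0 mul1r -expR0 ler_expR lerNl oppr0.
have m0 : 0 < m.+1%:R :> R by rewrite ltr0n.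
have h : (y / m.+1%:R) ^+ m.+1 <= expR y.
  rewrite -[X in expR X](divfK (lt0r_neq0 m0)) expRM_natr.
  rewrite lerXn2r ?nnegrE ?expR_ge0 ?divr_ge0 ?(ltW m0) //.
  by apply: le_trans (expR_ge1Dx _); rewrite lerDr.
rewrite expRN ler_pdivrMr ?expR_gt0 //.
by move: h; rewrite expr_div_n ler_pdivrMr ?exprn_gt0 // mulrC.
Qed.

Lemma flat_ge0 k x : 0 <= flat k x.
Proof.
rewrite /flat; case: ifP => // x0.
by rewrite mulr_ge0 ?expR_ge0 // invr_ge0 exprn_ge0 // ltW.
Qed.

(** The preceding bound at [y = 1/x] and exponent [k + 2], where two powers pay for [x ^+ 2]. A
    quadratic bound is what gives derivative 0 at the origin. *)
Lemma flat_le k x : flat k x <= k.+2%:R ^+ k.+2 * x ^+ 2.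
Proof.
rewrite /flat; case: ifP => [x0|_]; last by rewrite mulr_ge0 ?sqr_ge0 ?exprn_ge0.
rewrite -ler_pdivrMr ?exprn_gt0 //; have xi0 : 0 <= x^-1 by rewrite invr_ge0 ltW.
apply: le_trans (expR_powM_le k.+2 xi0).
rewrite mulrAC ler_wpM2r ?expR_ge0 // exprVn -invfM.
by rewrite -exprD addn2.
Qed.

Lemma is_derive_flat0 k : is_derive (0 : R) (1 : R) (flat k) 0.
Proof.
suff h : (fun h : R => h^-1 *: ((flat k \o shift 0) (h *: 1) - flat k 0)) @ 0^'
    --> (0 : R).
  apply: DeriveDef; first by apply/cvg_ex; exists 0; exact: h.
  exact: (cvg_lim (@Rhausdorff R) h).
pose K : R := k.+2%:R ^+ k.+2.
have K0 : 0 <= K by rewrite exprn_ge0.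
have hK : (fun h : R => K * `|h|) @ 0^' --> (0 : R).
  rewrite -[X in _ --> X](mulr0 K); apply: cvgMl_tmp.
  apply: cvg_trans (_ : Num.norm @ (0 : R) --> (0 : R)).
    by apply: cvg_app; exact: nbhs_dnbhs.
  by have := @norm_continuous _ _ (0 : R); rewrite /continuous_at normr0.
apply/norm_cvg0P; apply: (cvg0_dom (g := fun h : R => K * `|h|)) => [h|//].
rewrite normr_ge0 /= addr0 -[h *: 1]/(h * 1) mulr1 {2}/flat ltxx subr0.
rewrite normrM normfV; have [->|h0] := eqVneq h 0.
  by rewrite normr0 invr0 mul0r mulr0.
rewrite mulrC ler_pdivrMr ?normr_gt0 // -mulrA -expr2 (ger0_norm (flat_ge0 _ _)).
by rewrite real_normK ?num_real // flat_le.
Qed.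

Lemma is_derive_flat k x :
  is_derive x (1 : R) (flat k) (- k%:R * flat k.+1 x + flat k.+2 x).
Proof.
have [x0|x0|->] := ltgtP x 0.
- rewrite [flat k.+1 x]/flat [flat k.+2 x]/flat lt_gtF // mulr0 addr0.
  apply: (near_eq_is_derive (f := cst 0)) => //.
    near=> y; rewrite /flat lt_gtF //; near: y; exact: lt_nbhsl.
- rewrite [flat k.+1 x]/flat [flat k.+2 x]/flat x0.
  apply: (near_eq_is_derive (f := (fun y : R => y ^- k * expR (- y^-1)) : R -> R)) => //.
    near=> y; rewrite /flat ifT //; near: y; exact: lt_nbhsr.
  have xn0 : x != 0 by rewrite gt_eqF.
  have d1 : is_derive x (1 : R) (fun y : R => (y ^+ k)^-1)
      (- (x ^+ k) ^- 2 * (k%:R * x ^+ k.-1)).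
    apply: is_deriveV; first by rewrite expf_neq0.
    have -> : (fun y : R => y ^+ k) = (id : R -> R) ^+ k.
      by apply/funext => y; rewrite exprfctE.
    by apply: is_derive_eq; exact: mulr1.
  have d2 : is_derive x (1 : R) (fun y : R => expR (- y^-1))
      (expR (- x^-1) * x ^- 2).
    apply: (@is_derive1_comp _ expR (fun y : R => - y^-1)).
    have d0 : is_derive x (1 : R) (fun y : R => y^-1) (- x ^- 2 *: 1).
      by apply: (is_deriveV (f := id)) => //; exact: is_derive_id.
    apply: (@is_derive_eq _ _ _ _ _ _ _ _ (is_deriveN d0)).
    by rewrite /GRing.scale /= mulr1 opprK.
  apply: (@is_derive_eq _ _ _ _ _ _ _ _ (is_deriveM d1 d2)).
  rewrite /GRing.scale /=; case: (k) => [|m] /=.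
    by field.
  rewrite !exprS; field.
  by rewrite xn0 expf_neq0.
rewrite [flat k.+1 0]/flat [flat k.+2 0]/flat ltxx mulr0 addr0.
exact: is_derive_flat0.
Unshelve. all: by end_near.
Qed.

End FlatFunction.

(** * Derivatives of complex exponentials and of linear combinations *)

Section ScalarDerivatives.
Variables (R : realType) (n : nat).
Local Notation C := (cplx R).

Lemma rder_rc (g : R -> R) (t l : R) : is_derive t (1 : R) g l ->
  rder (fun x => rc (g x)) t (rc l).
Proof. by move=> h; split=> //=; exact: is_derive_cst. Qed.

Lemma rder_cexp (z : C) (L : R -> R) (t l : R) : is_derive t (1 : R) L l ->
  rder (fun x => cexp (z * rc (L x))) t (z * rc l * cexp (z * rc (L t))).
Proof.
move=> h; pose a := re z; pose b := im z.
have reE (y : R) : re (cexp (z * rc y)) = expR (a * y) * cos (b * y).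
  by rewrite /cexp !reimE /= !(mulr0, mul0r, subr0, add0r).
have imE (y : R) : im (cexp (z * rc y)) = expR (a * y) * sin (b * y).
  by rewrite /cexp !reimE /= !(mulr0, mul0r, subr0, add0r, addr0).
have da : is_derive t (1 : R) (fun x => a * L x) (a * l).
  exact: (is_deriveZ a h).
have db : is_derive t (1 : R) (fun x => b * L x) (b * l).
  exact: (is_deriveZ b h).
have de := is_derive1_comp (g := fun x => a * L x) (is_derive_expR (a * L t)) da.
have dc := is_derive1_comp (g := fun x => b * L x) (is_derive_cos (b * L t)) db.
have ds := is_derive1_comp (g := fun x => b * L x) (is_derive_sin (b * L t)) db.
have re_zl : re (z * rc l) = a * l by rewrite reM /= mulr0 subr0.
have im_zl : im (z * rc l) = b * l by rewrite imM /= mulr0 add0r.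
split.
  rewrite (_ : (fun x => _) = (fun x => expR (a * L x) * cos (b * L x))).
    apply: (@is_derive_eq _ _ _ _ _ _ _ _ (is_deriveM de dc)).
    by rewrite reM reE imE re_zl im_zl /GRing.scale /=; ring.
  by apply/funext => x; rewrite reE.
rewrite (_ : (fun x => _) = (fun x => expR (a * L x) * sin (b * L x))).
  apply: (@is_derive_eq _ _ _ _ _ _ _ _ (is_deriveM de ds)).
  by rewrite imM reE imE re_zl im_zl /GRing.scale /=; ring.
by apply/funext => x; rewrite imE.
Qed.

Lemma sderiv_lin (j : 'I_n) (a : C) (c c' : 'rV[R]_n -> C) xi l l' :
  sderiv j c xi l -> sderiv j c' xi l' ->
  sderiv j (fun eta => a * c eta + c' eta) xi (a * l + l').
Proof.
move=> h h'.
pose q (d : 'rV[R]_n -> C) (m : C) (t : R) :=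
  rnorm (rc t^-1 * (d (xi + t *: delta_mx 0 j) - d xi) - m).
apply: (cvg0_dom (g := fun t => rnorm a * q c l t + q c' l' t)) => [t|].
  rewrite rnorm_ge0 /= /q -rnormM; apply: le_trans (rnormD _ _).
  by rewrite le_eqVlt; apply/orP; left; apply/eqP; congr rnorm; ring.
rewrite -[X in _ --> X]addr0 -[X in X + _](mulr0 (rnorm a)).
by apply: cvgD; [apply: cvgMl_tmp; exact: h|exact: h'].
Qed.

Lemma sderiv_cst (j : 'I_n) (a : C) xi : sderiv j (fun=> a) xi 0.
Proof.
rewrite /sderiv; under eq_cvg do rewrite subrr mulr0 subrr rnorm0.
exact: cvg_cst.
Qed.

End ScalarDerivatives.

(** * Coordinates, flat functions, logarithms and powers as multipliers *)

Section ConcreteMultipliers.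
Variables (R : realType) (n : nat).
Local Notation C := (cplx R).
Variables (A : cstarAlgType C) (theta : 'M[R]_n) (U : 'I_n -> A).
Hypothesis hU : is_nctorus theta U.
Variable V : set 'rV[R]_n.
Hypothesis oV : open V.
Local Notation mult := (mult U V).

Lemma mult_coord d i : mult d (fun eta => rc (eta 0 i)).
Proof.
elim: d => [//|d ih]; apply: (multS hU oV (c' := fun j _ => (i == j)%:R)) => //.
- by move=> xi _; exact: scont_coord.
- by move=> j xi _; exact: sderiv_coord.
- by move=> j; apply: (mult_cst hU oV).
Qed.

Lemma mult_radialS d (F F' : R -> C) :
  (forall xi, V xi -> rder F (ssq xi) (F' (ssq xi))) ->
  mult d (fun eta => F (ssq eta)) -> mult d (fun eta => F' (ssq eta)) ->
  mult d.+1 (fun eta => F (ssq eta)).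
Proof.
move=> FF' hF hF'.
apply: (multS hU oV (c' := fun j eta => rc (2 * eta 0 j) * F' (ssq eta))) => //.
- by move=> xi Vxi; exact: scont_radial (FF' _ Vxi).
- by move=> j xi Vxi; exact: sderiv_radial (FF' _ Vxi).
move=> j; apply: (multM oV) => //.
apply: (mult_ext oV (c := fun eta => rc 2 * rc (eta 0 j))) => [eta _|].
  by rewrite rcM.
by apply: (multM oV); [exact: (mult_cst hU oV)|exact: mult_coord].
Qed.

(** Differentiation only shifts the index of [flat], so the induction on [d] is carried out for all
    [k] simultaneously. *)
Lemma mult_flat d k : mult d (fun eta => rc (flat k (2^-1 - ssq eta))).
Proof.
elim: d k => [//|d ih] k.
apply: (mult_radialS (F := fun t => rc (flat k (2^-1 - t)))
  (F' := fun t => rc (k%:R * flat k.+1 (2^-1 - t) - flat k.+2 (2^-1 - t)))) => //.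
  move=> xi _; apply: rder_rc.
  have d1 : is_derive (ssq xi) (1 : R) (fun t : R => 2^-1 - t) (- 1).
    apply: (@is_derive_eq _ _ _ _ _ _ _ _
      (is_deriveB (is_derive_cst _ _ _) (is_derive_id _ _))).
    exact: sub0r.
  have d2 := is_derive1_comp (g := fun t => 2^-1 - t)
    (is_derive_flat k (2^-1 - ssq xi)) d1.
  by apply: (@is_derive_eq _ _ _ _ _ _ _ _ d2); ring.
apply: (mult_ext oV (c := fun eta => rc k%:R * rc (flat k.+1 (2^-1 - ssq eta))
  + (-1) * rc (flat k.+2 (2^-1 - ssq eta)))) => [eta _|].
  by rewrite mulN1r rcD rcN rcM.
by apply: (multD hU oV); apply: (multM oV) => //; exact: (mult_cst hU oV).
Qed.

Section Positive.
Variables (tau tau' : R -> R).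
Hypothesis tau_gt0 : forall xi, V xi -> 0 < tau (ssq xi).
Hypothesis dtau : forall xi, V xi ->
  is_derive (ssq xi) (1 : R) tau (tau' (ssq xi)).
Hypothesis mult_tau' : forall d, mult d (fun eta => rc (tau' (ssq eta))).

(** The exponent for which [cexp (z * loglam xi)] is [tau(|xi|^2)^(z/2)]; it is [log |xi|] for
    [tau = id]. Keeping [tau] abstract serves both the smooth weight on the whole space and [|xi|^z]
    off the origin. *)
Definition loglam (xi : 'rV[R]_n) : C := rc (ln (tau (ssq xi)) / 2).

(** The partial derivative of [loglam] in direction [j]; no logarithm is left in it. *)
Definition lognu (j : 'I_n) (xi : 'rV[R]_n) : C :=
  rc (tau' (ssq xi) / tau (ssq xi) * xi 0 j).

(** The derivative of [1 / tau] is [- tau'] times two copies of [1 / tau], so the induction on [d]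
    closes. *)
Lemma mult_tauV d : mult d (fun eta => rc (tau (ssq eta))^-1).
Proof.
elim: d => [//|d ih].
apply: (mult_radialS (F := fun t => rc (tau t)^-1)
  (F' := fun t => rc (- (tau t) ^- 2 * tau' t))) => //.
  move=> xi Vxi; apply: rder_rc.
  apply: (is_deriveV (f := tau)); last exact: dtau.
  by rewrite gt_eqF // tau_gt0.
apply: (mult_ext oV (c := fun eta => -1 * (rc (tau (ssq eta))^-1 *
    rc (tau (ssq eta))^-1) * rc (tau' (ssq eta)))) => [eta _|].
  by rewrite mulN1r -rcM -rcN -rcM -invfM -expr2.
apply: (multM oV) => //; apply: (multM oV); first exact: (mult_cst hU oV).
exact: (multM oV).
Qed.

Lemma is_derive_loglam xi : V xi ->
  is_derive (ssq xi) (1 : R) (fun t => ln (tau t) / 2)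
    (tau' (ssq xi) / tau (ssq xi) / 2).
Proof.
move=> Vxi.
have dln := is_derive1_comp (is_derive1_ln (tau_gt0 Vxi)) (dtau Vxi).
have -> : (fun t => ln (tau t) / 2) = (2^-1 \*: (@ln R \o tau)).
  by apply/funext => t; rewrite /= mulrC.
apply: (@is_derive_eq _ _ _ _ _ _ _ _ (is_deriveZ 2^-1 dln)).
by rewrite /GRing.scale /=; ring.
Qed.

Lemma sderiv_loglam j xi : V xi -> sderiv j loglam xi (lognu j xi).
Proof.
move=> Vxi; have := sderiv_radial j (rder_rc (is_derive_loglam Vxi)).
rewrite -rcM (_ : 2 * _ * _ = tau' (ssq xi) / tau (ssq xi) * xi 0 j) //.
by field; rewrite gt_eqF // tau_gt0.
Qed.

Lemma sderiv_cexp_loglam z j xi : V xi ->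
  sderiv j (fun eta => cexp (z * loglam eta)) xi
    (z * lognu j xi * cexp (z * loglam xi)).
Proof.
move=> Vxi; have := sderiv_radial j (rder_cexp z (is_derive_loglam Vxi)).
rewrite mulrA (mulrCA (rc _) z) -rcM.
rewrite (_ : 2 * _ * _ = tau' (ssq xi) / tau (ssq xi) * xi 0 j) //.
by field; rewrite gt_eqF // tau_gt0.
Qed.

Lemma mult_lognu d j : mult d (lognu j).
Proof.
apply: (mult_ext oV (c := fun eta => rc (tau' (ssq eta)) *
  rc (tau (ssq eta))^-1 * rc (eta 0 j))) => [eta _|].
  by rewrite -!rcM.
apply: (multM oV); last exact: mult_coord.
by apply: (multM oV) => //; exact: mult_tauV.
Qed.

Lemma mult_loglam d : mult d loglam.
Proof.
elim: d => [//|d ih].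
apply: (multS hU oV (c' := lognu)) => //.
- by move=> xi Vxi; exact: (scont_radial (rder_rc (is_derive_loglam Vxi))).
- by move=> j xi Vxi; exact: sderiv_loglam.
- by move=> j; exact: mult_lognu.
Qed.

Lemma mult_cexp_loglam z d : mult d (fun eta => cexp (z * loglam eta)).
Proof.
elim: d => [//|d ih].
apply: (multS hU oV (c' := fun j eta =>
  z * lognu j eta * cexp (z * loglam eta))) => //.
- by move=> xi Vxi; exact: (scont_radial (rder_cexp z (is_derive_loglam Vxi))).
- by move=> j xi Vxi; exact: sderiv_cexp_loglam.
move=> j; apply: (multM oV) => //; apply: (multM oV); first exact: (mult_cst hU oV).
exact: mult_lognu.
Qed.

End Positive.

End ConcreteMultipliers.

(** * Multi-orders as lists of derivatives *)

Section MultiindexLists.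
Variable n : nat.
Implicit Types (beta : 'I_n -> nat) (e js : seq 'I_n).

Lemma subseq_catP (T : eqType) (s s1 s2 : seq T) : subseq s (s1 ++ s2) ->
  exists a b, [/\ s = a ++ b, subseq a s1 & subseq b s2].
Proof.
case/subseqP => m sm ->; exists (mask (take (size s1) m) s1).
exists (mask (drop (size s1) m) s2); split; last 2 first.
- exact: mask_subseq.
- exact: mask_subseq.
rewrite -mask_cat ?cat_take_drop // size_takel // sm size_cat leq_addr //.
Qed.

Lemma subseq_rconsP (T : eqType) (s s' : seq T) (x : T) :
  subseq s (rcons s' x) ->
  subseq s s' \/ exists2 s3, s = rcons s3 x & subseq s3 s'.
Proof.
rewrite -cats1 => /subseq_catP[a [b [-> sa]]].
case: b => [|y [|? b]] sb; first by rewrite cats0; left.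
  right; exists a => //; have := mem_subseq sb (mem_head _ _).
  by rewrite inE => /eqP ->; rewrite cats1.
by have := size_subseq sb.
Qed.

(** The order of differentiation of [pderivs beta], when [e] enumerates the indices. *)
Definition multilist e beta := flatten [seq nseq (beta j) j | j <- e].

Lemma size_multilist beta :
  size (multilist (enum 'I_n) beta) = (\sum_j beta j)%N.
Proof.
rewrite /multilist size_flatten /shape -map_comp sumnE big_map big_enum /=.
by apply: eq_bigr => j _; rewrite size_nseq.
Qed.

(** A subsequence cuts a shorter constant block out of each constant block. Hence the lists left
    over by repeated use of the Leibniz rule still come from multi-orders, for which the symbol
    estimates are given. *)
Lemma subseq_multilist e beta js : uniq e -> subseq js (multilist e beta) ->
  exists beta', js = multilist e beta'.
Proof.
elim: e js => [|j e ih] js /=.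
  by move=> _; rewrite /multilist /= => /eqP ->; exists (fun=> 0%N).
case/andP => je ue /subseq_catP[a [b [-> sa /(ih _ ue)[beta' ->]]]].
(* As [j] does not occur in the rest of [e], resetting its multiplicity does not disturb the other
   blocks. *)
exists (fun i => if i == j then size a else beta' i).
rewrite /multilist /= eqxx; congr (_ ++ _).
  apply/all_pred1P/allP => x /(mem_subseq sa).
  by rewrite mem_nseq => /andP[_ /eqP ->] /=.
congr flatten; apply/eq_in_map => i ie.
by case: eqP => // ij; rewrite -ij ie in je.
Qed.

End MultiindexLists.

Lemma pderivs_multilist (R : realType) (n : nat) (A : cstarAlgType (cplx R))
    (U : 'I_n -> A) (beta : 'I_n -> nat) (f : 'rV[R]_n -> smooth_torus U) :
  pderivs beta f = foldr (@pderiv R n A U) f (multilist (enum 'I_n) beta).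
Proof.
rewrite /pderivs /multilist; elim: (enum 'I_n) => //= j e ->.
rewrite foldr_cat; set g := foldr _ f _.
by elim: (beta j) => //= m ->.
Qed.

(** * Growth estimates under multiplication by coordinates and powers of the norm *)

Section SymbolEstimates.
Variables (R : realType) (n : nat).
Local Notation C := (cplx R).
Variables (A : cstarAlgType C) (theta : 'M[R]_n) (U : 'I_n -> A).
Hypothesis hU : is_nctorus theta U.
Local Notation E := (smooth_torus U).
Local Notation symb := ('rV[R]_n -> E).
Local Notation p := (@torus_seminorm R n A U).
Local Notation D := (foldr (@pderiv R n A U)).

Implicit Types (f g : symb) (xi : 'rV[R]_n).

Definition punctured : set 'rV[R]_n := [set xi | xi != 0].
Local Notation V0 := punctured.

Lemma open_ssq_gt (a : R) : open [set xi : 'rV[R]_n | a < ssq xi].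
Proof.
apply: (@open_comp _ _ (@ssq R n) [set t | a < t]); last exact: open_gt.
by move=> xi _; exact: ssq_continuous.
Qed.

Lemma punctured_open : open V0.
Proof.
rewrite (_ : V0 = [set xi | 0 < ssq xi]); first exact: open_ssq_gt.
apply/seteqP; split=> xi /=; first exact: ssq_gt0.
apply: contraTneq => ->; rewrite /ssq big1 ?ltxx // => j _.
by rewrite mxE expr0n.
Qed.

Lemma enorm_ge1_neq0 (xi : 'rV[R]_n) : 1 <= enorm xi -> V0 xi.
Proof.
move=> h; apply/eqP => xi0; move: h; rewrite xi0 /enorm big1 ?sqrtr0.
  by rewrite ler10.
by move=> j _; rewrite mxE expr0n.
Qed.

Lemma enorm_sqr (xi : 'rV[R]_n) : enorm xi ^+ 2 = ssq xi.
Proof. by rewrite sqr_sqrtr // ssq_ge0. Qed.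

Lemma powR_mul (x a b : R) : 1 <= x -> x `^ a * x `^ b = x `^ (a + b).
Proof.
move=> x1; have x0 : x != 0 by rewrite gt_eqF // (lt_le_trans ltr01).
by rewrite powRD // x0 implybT.
Qed.

(* Only derivatives along subsequences of [js] are controlled: the symbol
   estimates are given for derivatives taken in a fixed order, and partial
   derivatives are not known to commute. *)
Definition sym_bound (js : seq 'I_n) (s : R) (f : symb) : Prop :=
  forall js', subseq js' js -> forall al, exists c, forall xi,
    1 <= enorm xi -> p al (D f js' xi) <= c * enorm xi `^ (s - (size js')%:R).

Lemma sym_bound_ext js s f g : (forall eta, V0 eta -> f eta = g eta) ->
  sym_bound js s f -> sym_bound js s g.
Proof.
move=> fg hf js' sjs al; have [c hc] := hf js' sjs al; exists c => xi xi1.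
rewrite -(pderivs_list_ext punctured_open js' fg) ?hc //.
exact: enorm_ge1_neq0.
Qed.

Lemma sym_bound_lin js s f g (a : C) : smooth_on V0 f -> smooth_on V0 g ->
  sym_bound js s f -> sym_bound js s g ->
  sym_bound js s (fun eta => a *: f eta + g eta).
Proof.
move=> sf sg hf hg js' sjs al; have [c hc] := hf js' sjs al.
have [c' hc'] := hg js' sjs al; exists (rnorm a * c + c') => xi xi1.
rewrite (pderivs_list_linS hU punctured_open) //; last exact: enorm_ge1_neq0.
rewrite (le_trans (tsemiD hU _ _ _)) // (tsemiZ hU) mulrDl -mulrA.
by rewrite lerD ?hc' // ler_wpM2l ?rnorm_ge0 ?hc.
Qed.

(** A subsequence either omits the final [j] or ends in it; then [j] is the innermost derivative and
    accounts for one order of decay. *)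
Lemma sym_bound_rcons js j s f :
  sym_bound (rcons js j) s f <->
  sym_bound js s f /\ sym_bound js (s - 1) (pderiv j f).
Proof.
split=> [h|[h1 h2] js' /subseq_rconsP[|[s3 -> s3s]] al]; last 2 first.
- by move=> sjs; exact: h1.
- have [c hc] := h2 _ s3s al; exists c => xi xi1.
  rewrite foldr_rcons size_rcons -natr1.
  by rewrite (_ : s - (_ + 1) = s - 1 - (size s3)%:R) ?hc //; ring.
split=> js' sjs al.
  by apply: h; apply: subseq_trans sjs _; exact: subseq_rcons.
have [|c hc] := h (rcons js' j) _ al.
  by rewrite -!cats1; apply: cat_subseq.
exists c => xi xi1; have := hc xi xi1.
rewrite foldr_rcons size_rcons -natr1.
by rewrite (_ : s - (_ + 1) = s - 1 - (size js')%:R) //; ring.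
Qed.

Lemma mult_punctured_inv d : mult U V0 d (fun eta => rc (ssq eta)^-1).
Proof.
apply: (mult_tauV hU punctured_open (tau := id) (tau' := fun=> 1)).
- by move=> xi xi0; exact: ssq_gt0.
- by move=> e; exact: (mult_cst hU punctured_open).
Qed.

Lemma pderiv_coord j k f xi : smooth_on V0 f -> V0 xi ->
  pderiv j (fun eta => rc (eta 0 k) *: f eta) xi =
  (k == j)%:R *: f xi + rc (xi 0 k) *: pderiv j f xi.
Proof.
by move=> sf Vxi; apply: (pderiv_scale hU sf Vxi); exact: sderiv_coord.
Qed.

Lemma pderiv_inv j f xi : smooth_on V0 f -> V0 xi ->
  pderiv j (fun eta => rc (ssq eta)^-1 *: f eta) xi =
  (- 2) *: (rc (xi 0 j) *: (rc (ssq xi)^-1 *: (rc (ssq xi)^-1 *: f xi)))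
  + rc (ssq xi)^-1 *: pderiv j f xi.
Proof.
move=> sf Vxi; rewrite !scalerA; apply: (pderiv_scale hU sf Vxi).
have s0 : ssq xi != 0 by rewrite gt_eqF // ssq_gt0.
have d1 : is_derive (ssq xi) (1 : R) (fun t : R => t^-1) (- (ssq xi) ^- 2 *: 1).
  by apply: (is_deriveV (f := id)) => //; exact: is_derive_id.
have := sderiv_radial j (rder_rc d1).
rewrite [X in sderiv _ _ _ X](_ : _ =
  - 2 * rc (xi 0 j) * rc (ssq xi)^-1 * rc (ssq xi)^-1).
  by rewrite !mulrA.
rewrite /GRing.scale /= mulr1 rcM rcN expr2 invfM rcM.
by rewrite (_ : rc 2 = 2) -?natr_rc //; ring.
Qed.

Lemma smooth_coord k f : smooth_on V0 f ->
  smooth_on V0 (fun eta => rc (eta 0 k) *: f eta).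
Proof.
by apply: smooth_on_mult => d; exact: (mult_coord hU punctured_open).
Qed.

Lemma smooth_inv f : smooth_on V0 f ->
  smooth_on V0 (fun eta => rc (ssq eta)^-1 *: f eta).
Proof. by apply: smooth_on_mult => d; exact: mult_punctured_inv. Qed.

Lemma sym_bound_coord js s k f : smooth_on V0 f -> sym_bound js s f ->
  sym_bound js (s + 1) (fun eta => rc (eta 0 k) *: f eta).
Proof.
elim/last_ind: js s f => [|js j ih] s f sf.
  move=> hf js' /eqP -> al; have [c hc] := hf [::] isT al.
  exists c => xi xi1 /=.
  rewrite (tsemiZ hU) rnorm_rc subr0 addrC -powR_mul // powRr1 ?enorm_ge0 //.
  rewrite mulrCA ler_pM ?tsemi_ge0 ?normr_ge0 ?entry_le_enorm //.
  by have := hc xi xi1; rewrite subr0.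
case/sym_bound_rcons => h1 h2; apply/sym_bound_rcons; split; first exact: ih.
have sf' := smooth_on_pderiv j sf.
apply: (sym_bound_ext (f := fun eta =>
    (k == j)%:R *: f eta + rc (eta 0 k) *: pderiv j f eta)).
  by move=> eta Veta; rewrite pderiv_coord.
rewrite addrK; apply: sym_bound_lin => //; first exact: smooth_coord.
by have := ih _ _ sf' h2; rewrite subrK.
Qed.

(** Differentiating [|xi|^-2] yields [-2 xi_j |xi|^-4]: one coordinate and two factors of the same
    kind. The induction hypothesis, used twice, gives order [s - 4 + 1], which is the required
    [s - 2 - 1]. *)
Lemma sym_bound_inv js s f : smooth_on V0 f -> sym_bound js s f ->
  sym_bound js (s - 2) (fun eta => rc (ssq eta)^-1 *: f eta).
Proof.
elim/last_ind: js s f => [|js j ih] s f sf.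
  move=> hf js' /eqP -> al; have [c hc] := hf [::] isT al.
  exists c => xi xi1 /=; have e0 : 0 < enorm xi by apply: lt_le_trans xi1.
  rewrite (tsemiZ hU) rnorm_rc subr0 addrC -powR_mul // mulrCA.
  rewrite powRN powR_mulrn ?enorm_ge0 // enorm_sqr.
  rewrite ger0_norm ?invr_ge0 ?ssq_ge0 // ler_wpM2l ?invr_ge0 ?ssq_ge0 //.
  by have := hc xi xi1; rewrite subr0.
case/sym_bound_rcons => h1 h2; apply/sym_bound_rcons; split; first exact: ih.
have sf' := smooth_on_pderiv j sf.
apply: (sym_bound_ext (f := fun eta =>
  (- 2) *: (rc (eta 0 j) *: (rc (ssq eta)^-1 *: (rc (ssq eta)^-1 *: f eta)))
  + rc (ssq eta)^-1 *: pderiv j f eta)).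
  by move=> eta Veta; rewrite pderiv_inv.
have s1 := smooth_inv sf; have s2 := smooth_inv s1.
apply: sym_bound_lin; first exact: smooth_coord.
- exact: smooth_inv.
- rewrite (_ : s - 2 - 1 = s - 2 - 2 + 1); last by ring.
  by apply: sym_bound_coord => //; apply: (ih _ _ s1); exact: ih.
rewrite (_ : s - 2 - 1 = s - 1 - 2); last by ring.
exact: ih.
Qed.

(** The modulus of [|xi|^z] is exactly [|xi|^(re z)], which goes into the power on the right. A
    derivative turns [|xi|^z f] into [|xi|^z] times functions of order [s - 1], one of them with a
    factor [z]; so the constant depends on [M] but not on [z]. *)
Lemma sym_bound_cexp js s f (M : R) : smooth_on V0 f -> sym_bound js s f ->
  forall js', subseq js' js -> forall al, exists c, forall (z : C) xi,
    rnorm z <= M -> 1 <= enorm xi ->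
    p al (D (fun eta => cexp (z * loglam id eta) *: f eta) js' xi) <=
    c * enorm xi `^ (re z + s - (size js')%:R).
Proof.
have tau0 (xi : 'rV[R]_n) : V0 xi -> 0 < id (ssq xi) by exact: ssq_gt0.
have dtau (xi : 'rV[R]_n) : V0 xi -> is_derive (ssq xi) (1 : R) id ((fun=> 1) (ssq xi)).
  by move=> _; exact: is_derive_id.
have mtau d : mult U V0 d (fun eta => rc ((fun=> 1) (ssq eta))).
  exact: (mult_cst hU punctured_open).
have mg z := mult_cexp_loglam (tau' := fun=> 1) hU punctured_open tau0 dtau mtau z.
have sg z g : smooth_on V0 g ->
    smooth_on V0 (fun eta => cexp (z * loglam id eta) *: g eta).
  by apply: smooth_on_mult => d; exact: mg.
elim/last_ind: js s f => [|js j ih] s f sf hf js'.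
  move=> /eqP -> al; have [c hc] := hf [::] isT al.
  exists c => z xi zM xi1 /=; have e0 : 0 < enorm xi by apply: lt_le_trans xi1.
  rewrite (tsemiZ hU) rnorm_cexp /= subr0 -powR_mul // mulrCA.
  have := hc xi xi1; rewrite subr0 => h.
  have re_lam : re (z * loglam id xi) = re z * ln (enorm xi).
    rewrite reM /= mulr0 subr0 -enorm_sqr lnXn // -[_ *+ 2]mulr_natr.
    by rewrite mulfK ?pnatr_eq0.
  by rewrite re_lam [enorm xi `^ re z]/powR gt_eqF // ler_wpM2l ?expR_ge0.
move: hf => /sym_bound_rcons[h1 h2].
case/subseq_rconsP => [sjs|[s3 -> s3s]] al; first exact: ih sf h1 _ sjs al.
have sf' := smooth_on_pderiv j sf.
(* This is [f] times the derivative [xi_j / |xi|^2] of [log |xi|]. *)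
pose nu_f : symb := fun eta => rc (eta 0 j) *: (rc (ssq eta)^-1 *: f eta).
have snu : smooth_on V0 nu_f by apply: smooth_coord; exact: smooth_inv.
have hnu : sym_bound js (s - 1) nu_f.
  rewrite (_ : s - 1 = s - 2 + 1); last by ring.
  by apply: sym_bound_coord; [exact: smooth_inv|exact: sym_bound_inv].
have [c1 hc1] := ih _ _ snu hnu _ s3s al.
have [c2 hc2] := ih _ _ sf' h2 _ s3s al.
(* The absolute value is taken because the sign of [c1] is unknown when [rnorm z] is replaced by
   [M]. *)
exists (M * `|c1| + c2) => z xi zM xi1; have Vxi := enorm_ge1_neq0 xi1.
rewrite foldr_rcons size_rcons -natr1.
rewrite (_ : _ - _ = re z + (s - 1) - (size s3)%:R); last by ring.
rewrite (pderivs_list_ext punctured_open (g := fun eta =>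
    z *: (cexp (z * loglam id eta) *: nu_f eta) +
    cexp (z * loglam id eta) *: pderiv j f eta)) //; last first.
  move=> eta Veta.
  rewrite (pderiv_scale hU sf Veta (sderiv_cexp_loglam (tau' := fun=> 1) tau0 dtau z j Veta)).
  rewrite /nu_f !scalerA; congr (_ *: _ + _).
  by rewrite /lognu mul1r rcM; ring.
rewrite (pderivs_list_linS hU punctured_open) //; try exact: sg.
rewrite (le_trans (tsemiD hU _ _ _)) // (tsemiZ hU) mulrDl.
rewrite lerD ?hc2 // -mulrA ler_pM ?rnorm_ge0 ?tsemi_ge0 //.
apply: le_trans (hc1 z xi zM xi1) _.
by rewrite ler_wpM2r ?powR_ge0 // ler_norm.
Qed.

End SymbolEstimates.

(** * Taylor remainders of the complex exponential *)

Section ComplexExponentialBounds.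
Variable R : realType.
Local Notation C := (cplx R).

Lemma mean_value_bound (f df : R -> R) (K a : R) :
  (forall t, is_derive t (1 : R) f (df t)) ->
  (forall t, `|t| <= `|a| -> `|df t| <= K) -> `|f a - f 0| <= K * `|a|.
Proof.
move=> fd dK.
have fc (x y : R) : {within `[x, y], continuous f}.
  by apply: derivable_within_continuous => t _; case: (fd t).
have [a0|a0] := leP 0 a.
  have [c] := MVT_segment a0 (fun t _ => fd t) (fc 0 a).
  rewrite in_itv /= => /andP[c0 ca] ->; rewrite subr0 normrM ler_wpM2r //.
  by apply: dK; rewrite !ger0_norm.
have [c] := MVT_segment (ltW a0) (fun t _ => fd t) (fc a 0).
rewrite in_itv /= => /andP[c0 ca]; rewrite sub0r distrC => ->.
rewrite normrM normrN ler_wpM2r //.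
by apply: dK; rewrite !ler0_norm ?(ltW a0) // lerN2.
Qed.

Lemma sin_le (b : R) : `|sin b| <= `|b|.
Proof.
have := @mean_value_bound sin cos 1 b.
rewrite sin0 subr0 mul1r; apply => t.
by move=> _; rewrite ler_norml cos_geN1 cos_le1.
Qed.

Lemma cos_sub1_le (b : R) : `|cos b - 1| <= `|b| * `|b|.
Proof.
have := @mean_value_bound cos (fun t => - sin t) `|b| b.
rewrite cos0; apply => t.
by rewrite normrN; exact: le_trans (sin_le t).
Qed.

Lemma cos_sub1_le1 (b : R) : `|cos b - 1| <= `|b|.
Proof.
have := @mean_value_bound cos (fun t => - sin t) 1 b.
rewrite cos0 mul1r; apply => t.
by move=> _; rewrite normrN ler_norml sin_geN1 sin_le1.
Qed.

Lemma sin_sub_le (b : R) : `|sin b - b| <= `|b| * `|b|.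
Proof.
have := @mean_value_bound (fun t => sin t - t) (fun t => cos t - 1) `|b| b.
rewrite sin0 !subr0; apply => t tb.
exact: le_trans (cos_sub1_le1 t) tb.
Qed.

Lemma expR_sub1_le (a : R) : `|expR a - 1| <= expR `|a| * `|a|.
Proof.
have := @mean_value_bound expR expR (expR `|a|) a.
rewrite expR0; apply => t ta.
rewrite ger0_norm ?expR_ge0 // ler_expR.
exact: le_trans (ler_norm _) ta.
Qed.

Lemma expR_sub1_sub_le (a : R) : `|expR a - 1 - a| <= expR `|a| * `|a| * `|a|.
Proof.
have d (t : R) : is_derive t (1 : R) (fun t => expR t - 1 - t) (expR t - 1).
  have := is_deriveB (is_deriveB (is_derive_expR t)
    (is_derive_cst (1 : R) t (1 : R))) (is_derive_id t (1 : R)).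
  by rewrite subr0.
have := @mean_value_bound (fun t => expR t - 1 - t) (fun t => expR t - 1)
  (expR `|a| * `|a|) a.
rewrite expR0 subrr !subr0; apply => t ta.
apply: le_trans (expR_sub1_le t) _.
by rewrite ler_pM ?expR_ge0 // ler_expR.
Qed.

(** The real and imaginary parts split into three terms, each bounded by [exp(|w|) |w|]. *)
Lemma rnorm_cexp_sub1 (w : C) : rnorm (cexp w - 1) <= 3 * expR (rnorm w) * rnorm w.
Proof.
pose a := re w; pose b := im w; set N := rnorm w; set e := expR N.
have aN : `|a| <= N by exact: re_le_rnorm.
have bN : `|b| <= N by exact: im_le_rnorm.
have eae : expR a <= e by rewrite ler_expR (le_trans (ler_norm _)).
have ea0 := expR_ge0 a; have e0 : 0 <= e := expR_ge0 _.
apply: le_trans (rnorm_le_reim _) _.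
rewrite (_ : re _ = expR a * (cos b - 1) + (expR a - 1)); last first.
  by rewrite /cexp !reimE /= mul0r subr0; ring.
rewrite (_ : im _ = expR a * sin b); last first.
  by rewrite /cexp !reimE /= mul0r addr0 oppr0 addr0.
have h1 : `|expR a * (cos b - 1)| <= e * N.
  rewrite normrM (ger0_norm ea0) ler_pM //.
  exact: le_trans (cos_sub1_le1 b) bN.
have h2 : `|expR a - 1| <= e * N.
  by apply: le_trans (expR_sub1_le a) _; rewrite ler_pM ?expR_ge0 // ler_expR.
have h3 : `|expR a * sin b| <= e * N.
  by rewrite normrM (ger0_norm ea0) ler_pM //; exact: le_trans (sin_le b) bN.
rewrite -mulrA; apply: (@le_trans _ _ (e * N + e * N + e * N)).
  by rewrite lerD // (le_trans (ler_normD _ _)) // lerD.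
by rewrite le_eqVlt; apply/orP; left; apply/eqP; ring.
Qed.

(** Here the two parts split into four terms, each of second order in [|w|]. *)
Lemma rnorm_cexp_sub1_sub (w : C) :
  rnorm (cexp w - 1 - w) <= 4 * expR (rnorm w) * rnorm w ^+ 2.
Proof.
pose a := re w; pose b := im w; set N := rnorm w; set e := expR N.
have aN : `|a| <= N by exact: re_le_rnorm.
have bN : `|b| <= N by exact: im_le_rnorm.
have eae : expR a <= e by rewrite ler_expR (le_trans (ler_norm _)).
have ea0 := expR_ge0 a; have e0 : 0 <= e := expR_ge0 _.
have N0 : 0 <= N by exact: rnorm_ge0.
apply: le_trans (rnorm_le_reim _) _.
rewrite (_ : re _ = expR a * (cos b - 1) + (expR a - 1 - a)); last first.
  by rewrite /cexp !reimE /= mul0r subr0 -/a -/b; ring.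
rewrite (_ : im _ = expR a * (sin b - b) + (expR a - 1) * b); last first.
  by rewrite /cexp !reimE /= mul0r addr0 -/a -/b; ring.
have NN (x y : R) : `|x| <= N -> `|y| <= N -> `|x| * `|y| <= N ^+ 2.
  by move=> xN yN; rewrite expr2 ler_pM.
have h1 : `|expR a * (cos b - 1)| <= e * N ^+ 2.
  rewrite normrM (ger0_norm ea0) ler_pM //.
  exact: le_trans (cos_sub1_le b) (NN _ _ bN bN).
have h2 : `|expR a - 1 - a| <= e * N ^+ 2.
  apply: le_trans (expR_sub1_sub_le a) _; rewrite -mulrA.
  by rewrite ler_pM ?expR_ge0 ?mulr_ge0 ?NN // ler_expR.
have h3 : `|expR a * (sin b - b)| <= e * N ^+ 2.
  rewrite normrM (ger0_norm ea0) ler_pM //.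
  exact: le_trans (sin_sub_le b) (NN _ _ bN bN).
have h4 : `|(expR a - 1) * b| <= e * N ^+ 2.
  rewrite normrM expr2 mulrA ler_pM //.
  by apply: le_trans (expR_sub1_le a) _; rewrite ler_pM ?expR_ge0 // ler_expR.
rewrite -mulrA.
apply: (@le_trans _ _ ((e * N ^+ 2 + e * N ^+ 2) + (e * N ^+ 2 + e * N ^+ 2))).
  by rewrite lerD // (le_trans (ler_normD _ _)) // lerD.
by rewrite le_eqVlt; apply/orP; left; apply/eqP; ring.
Qed.

End ComplexExponentialBounds.

Lemma cvg_of_dist0 (R : realType) (T : Type) (F : set_system T) {FF : Filter F}
    (f : T -> R) (a : R) :
  (fun t => `|f t - a|) @ F --> (0 : R) -> f @ F --> a.
Proof. by move=> h; apply/subr_cvg0; apply/norm_cvg0P; exact: h. Qed.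

Lemma sderiv_eq (R : realType) (n : nat) (j : 'I_n) (c c' : 'rV[R]_n -> cplx R)
    xi l l' : c =1 c' -> l = l' -> sderiv j c xi l -> sderiv j c' xi l'.
Proof. by move=> /funext -> ->. Qed.

(** * Holomorphy of the family of symbols *)

Section HolomorphicFamily.
Variables (R : realType) (n : nat).
Local Notation C := (cplx R).
Variables (A : cstarAlgType C) (theta : 'M[R]_n) (U : 'I_n -> A).
Hypothesis hU : is_nctorus theta U.
Local Notation E := (smooth_torus U).
Local Notation symb := ('rV[R]_n -> E).
Local Notation p := (@torus_seminorm R n A U).
Local Notation D := (foldr (@pderiv R n A U)).
Implicit Types (f g : symb) (xi : 'rV[R]_n).

(* A smooth positive function of [t = |xi|^2 >= 0] equal to [t] for
   [t >= 1/2]. *)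
Definition smooth_sqr (t : R) : R := t + flat 0 (2^-1 - t).

Definition smooth_sqr' (t : R) : R := 1 - flat 2 (2^-1 - t).

Lemma smooth_sqrE (t : R) : 2^-1 < t -> smooth_sqr t = t.
Proof.
by move=> t2; rewrite /smooth_sqr /flat ltNge subr_le0 (ltW t2) addr0.
Qed.

(** At the origin positivity comes from the flat term alone, whose value is [exp(-2)]. *)
Lemma smooth_sqr_gt0 xi : [set: 'rV[R]_n] xi -> 0 < smooth_sqr (ssq xi).
Proof.
move=> _; have := ssq_ge0 xi; rewrite le_eqVlt => /orP[/eqP <-|s0].
  rewrite /smooth_sqr add0r subr0 /flat invr_gt0 ltr0n /=.
  by rewrite expr0 invr1 mul1r expR_gt0.
by rewrite ltr_wpDr // flat_ge0.
Qed.

Lemma is_derive_smooth_sqr xi : [set: 'rV[R]_n] xi ->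
  is_derive (ssq xi) (1 : R) smooth_sqr (smooth_sqr' (ssq xi)).
Proof.
move=> _; set t := ssq xi.
have d1 : is_derive t (1 : R) (fun t : R => 2^-1 - t) (- 1).
  apply: (@is_derive_eq _ _ _ _ _ _ _ _
    (is_deriveB (is_derive_cst _ _ _) (is_derive_id _ _))).
  exact: sub0r.
have d2 := is_derive1_comp (g := fun t => 2^-1 - t)
  (is_derive_flat 0 (2^-1 - t)) d1.
apply: (@is_derive_eq _ _ _ _ _ _ _ _ (is_deriveD (is_derive_id _ _) d2)).
by rewrite /smooth_sqr' oppr0 mul0r add0r mulrN1.
Qed.

Lemma mult_smooth_sqr' d :
  mult U setT d (fun eta => rc (smooth_sqr' (ssq eta))).
Proof.
apply: (mult_ext openT (c := fun eta => 1 + -1 * rc (flat 2 (2^-1 - ssq eta)))).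
  by move=> eta _; rewrite mulN1r -rcN -rc1 -rcD.
apply: (multD hU openT); first exact: (mult_cst hU openT).
apply: (multM openT); first exact: (mult_cst hU openT).
exact: (mult_flat hU openT).
Qed.

Local Notation lam := (@loglam R n smooth_sqr).
Local Notation nu := (@lognu R n smooth_sqr smooth_sqr').

Definition gauge_symbol (rho : symb) (z : C) : symb :=
  fun eta => cexp (z * lam eta) *: rho eta.

Lemma mult_cexp_lam z d : mult U setT d (fun eta => cexp (z * lam eta)).
Proof.
exact: (mult_cexp_loglam hU openT smooth_sqr_gt0 is_derive_smooth_sqr
  mult_smooth_sqr').
Qed.

Lemma mult_lam d : mult U setT d lam.
Proof.
exact: (mult_loglam hU openT smooth_sqr_gt0 is_derive_smooth_sqr
  mult_smooth_sqr').
Qed.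

Lemma mult_nu j d : mult U setT d (nu j).
Proof.
exact: (mult_lognu hU openT smooth_sqr_gt0 is_derive_smooth_sqr
  mult_smooth_sqr').
Qed.

Lemma sderiv_cexp_lam z j xi :
  sderiv j (fun eta => cexp (z * lam eta)) xi
    (z * nu j xi * cexp (z * lam xi)).
Proof. exact: (sderiv_cexp_loglam smooth_sqr_gt0 is_derive_smooth_sqr). Qed.

Lemma sderiv_lam j xi : sderiv j lam xi (nu j xi).
Proof. exact: (sderiv_loglam smooth_sqr_gt0 is_derive_smooth_sqr). Qed.

Lemma smooth_gauge_symbol rho z : smooth_on setT rho ->
  smooth_on setT (gauge_symbol rho z).
Proof. by apply: smooth_on_mult => d; exact: mult_cexp_lam. Qed.

Lemma continuous_bounded (g : 'rV[R]_n -> R) (K : set 'rV[R]_n) : compact K ->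
  (forall xi, g eta @[eta --> xi] --> g xi) ->
  exists c, forall xi, K xi -> `|g xi| <= c.
Proof.
move=> cK cg.
have := continuous_compact (continuous_subspaceT (A := K) cg) cK.
move=> /compact_bounded[M [_ hM]]; exists (M + 1) => xi Kxi.
by apply: (hM (M + 1)); [rewrite ltrDl|exists xi].
Qed.

Lemma tsemi_bounded f al (K : set 'rV[R]_n) : compact K -> smooth_on setT f ->
  exists c, forall xi, K xi -> p al (f xi) <= c.
Proof.
move=> cK sf; have [|c hc] := @continuous_bounded (fun xi => p al (f xi)) K cK.
  move=> xi; have [fc _] := sf [::] xi I.
  apply: (cvg_of_dist0 (FF := nbhs_filter xi)).
  apply: (cvg0_dom (FF := nbhs_filter xi)
    (g := fun eta => p al (f eta - f xi))) => [eta|]; last exact: fc.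
  rewrite normr_ge0 /= ler_norml lerNl opprB !lerBlDr.
  rewrite {1}(tsemi_subC hU).
  by apply/andP; split; rewrite (le_trans _ (tsemiD hU _ _ _)) // subrK.
by exists c => xi Kxi; apply: le_trans (hc xi Kxi); exact: ler_norm.
Qed.

Lemma lam_bounded (K : set 'rV[R]_n) : compact K ->
  exists c, forall xi, K xi -> rnorm (lam xi) <= c.
Proof.
move=> cK; have [|c hc] := @continuous_bounded (fun xi => rnorm (lam xi)) K cK.
  move=> xi; have fc : scont lam xi.
    exact: (scont_radial (rder_rc
      (is_derive_loglam smooth_sqr_gt0 is_derive_smooth_sqr I))).
  apply: (cvg_of_dist0 (FF := nbhs_filter xi)).
  apply: (cvg0_dom (FF := nbhs_filter xi)
    (g := fun eta => rnorm (lam eta - lam xi))) => [eta|]; last exact: fc.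
  rewrite normr_ge0 /= ler_norml lerNl opprB !lerBlDr.
  rewrite -{1}(rnormN (lam eta - lam xi)) opprB.
  by apply/andP; split; rewrite (le_trans _ (rnormD _ _)) // subrK.
by exists c => xi Kxi; apply: le_trans (hc xi Kxi); exact: ler_norm.
Qed.

Lemma mult_cexp_lam_sub1 h d :
  mult U setT d (fun eta => cexp (h * lam eta) - 1).
Proof.
apply: (multD hU openT); [exact: mult_cexp_lam|exact: (mult_cst hU openT)].
Qed.

(** Each derivative of [exp(h lambda) - 1] keeps a factor [h], so smallness in [h] survives
    differentiation. *)
Lemma cexp_sub1_small (K : set 'rV[R]_n) js f : compact K ->
  smooth_on setT f -> forall al, exists c, forall (h : C) xi,
  rnorm h <= 1 -> K xi ->
  p al (D (fun eta => (cexp (h * lam eta) - 1) *: f eta) js xi) <= c * rnorm h.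
Proof.
move=> cK; elim/last_ind: js f => [|js j ih] f sf al.
  have [c hc] := tsemi_bounded al cK sf; have [L hL] := lam_bounded cK.
  (* First-order exponential bound at [h * lam xi], whose norm is at most [rnorm h * L] and, as
     [rnorm h <= 1], at most [L]. *)
  exists (3 * expR L * L * c) => h xi h1 Kxi /=.
  have L0 : 0 <= L := le_trans (rnorm_ge0 _) (hL _ Kxi).
  have hhL : rnorm (h * lam xi) <= rnorm h * L.
    by rewrite rnormM ler_wpM2l ?rnorm_ge0 ?hL.
  have hL1 : rnorm (h * lam xi) <= L.
    by apply: le_trans hhL _; rewrite ler_piMl.
  rewrite (tsemiZ hU).
  have -> : 3 * expR L * L * c * rnorm h = 3 * expR L * (rnorm h * L) * c.
    by ring.
  rewrite ler_pM ?rnorm_ge0 ?tsemi_ge0 ?hc //.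
  apply: le_trans (rnorm_cexp_sub1 _) _.
  rewrite ler_pM ?mulr_ge0 ?expR_ge0 ?rnorm_ge0 //.
  by rewrite ler_pM2l // ler_expR.
have sf' := smooth_on_pderiv j sf.
have snu : smooth_on setT (fun eta => nu j eta *: f eta).
  by apply: smooth_on_mult sf => d; exact: mult_nu.
have sa h g : smooth_on setT g ->
    smooth_on setT (fun eta => (cexp (h * lam eta) - 1) *: g eta).
  by apply: smooth_on_mult => d; exact: mult_cexp_lam_sub1.
have [c1 hc1] := ih _ snu al; have [c2 hc2] := ih _ sf' al.
have [c0 hc0] := tsemi_bounded al cK (smooth_on_list js snu).
exists (c1 + (c0 + c2)) => h xi h1 Kxi; rewrite foldr_rcons.
(* Leibniz rule with the exponential written as [(cexp (h * lam eta) - 1) + 1]: the first and last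
   terms fall under the induction hypothesis, and the middle one is explicitly linear in [h]. *)
rewrite (pderivs_list_ext openT (g := fun eta =>
    h *: ((cexp (h * lam eta) - 1) *: (nu j eta *: f eta)) +
    (h *: (nu j eta *: f eta) + (cexp (h * lam eta) - 1) *: pderiv j f eta))) //;
    last first.
  move=> eta _.
  have d1 : sderiv j (fun eta => cexp (h * lam eta) - 1) eta
      (h * nu j eta * cexp (h * lam eta)).
    apply: sderiv_eq (sderiv_lin 1 (sderiv_cexp_lam h j eta)
      (sderiv_cst j (-1) eta)) => [x|]; first by rewrite mul1r.
    by rewrite mul1r addr0.
  rewrite (pderiv_scale hU sf I d1) addrA; congr (_ + _).
  by rewrite !scalerA -scalerDl; congr (_ *: _); ring.
have sh : smooth_on setT (fun eta => h *: (nu j eta *: f eta) +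
    (cexp (h * lam eta) - 1) *: pderiv j f eta).
  by apply: (smooth_on_lin hU openT) => //; exact: sa.
rewrite (pderivs_list_linS hU openT) //; last exact: sa.
rewrite (pderivs_list_linS hU openT) //; last exact: sa.
rewrite (le_trans (tsemiD hU _ _ _)) // mulrDl lerD //.
  rewrite (tsemiZ hU) (le_trans _ (hc1 h xi h1 Kxi)) //.
  by rewrite ler_piMl // tsemi_ge0.
rewrite (le_trans (tsemiD hU _ _ _)) // mulrDl lerD ?hc2 //.
by rewrite (tsemiZ hU) mulrC ler_wpM2r ?rnorm_ge0 ?hc0.
Qed.

Lemma mult_quotient h d :
  mult U setT d (fun eta => h^-1 * (cexp (h * lam eta) - 1) + -1 * lam eta).
Proof.
apply: (multD hU openT).
  apply: (multM openT (c := fun=> h^-1)); first exact: (mult_cst hU openT).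
  exact: mult_cexp_lam_sub1.
apply: (multM openT (c := fun=> -1)); first exact: (mult_cst hU openT).
exact: mult_lam.
Qed.

(** In the derivative of the coefficient the factor [h] cancels against [h^-1], leaving [nu j] times
    [exp(h lambda) - 1]; this is the previous estimate, and only the undifferentiated case needs the
    second-order bound. *)
Lemma quotient_small (K : set 'rV[R]_n) js f : compact K ->
  smooth_on setT f -> forall al, exists c, forall (h : C) xi,
  h != 0 -> rnorm h <= 1 -> K xi ->
  p al (D (fun eta => (h^-1 * (cexp (h * lam eta) - 1) + -1 * lam eta) *: f eta)
    js xi) <= c * rnorm h.
Proof.
move=> cK; elim/last_ind: js f => [|js j ih] f sf al.
  have [c hc] := tsemi_bounded al cK sf; have [L hL] := lam_bounded cK.
  exists (4 * expR L * L ^+ 2 * c) => h xi h0 h1 Kxi /=.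
  have L0 : 0 <= L := le_trans (rnorm_ge0 _) (hL _ Kxi).
  have hhL : rnorm (h * lam xi) <= rnorm h * L.
    by rewrite rnormM ler_wpM2l ?rnorm_ge0 ?hL.
  have hL1 : rnorm (h * lam xi) <= L.
    by apply: le_trans hhL _; rewrite ler_piMl.
  have rh0 : rnorm h != 0 by apply: contraNneq h0 => /rnorm_eq0 ->.
  rewrite (tsemiZ hU).
  have -> : 4 * expR L * L ^+ 2 * c * rnorm h =
      ((rnorm h)^-1 * (4 * expR L * (rnorm h * L) ^+ 2)) * c.
    by field.
  rewrite ler_pM ?rnorm_ge0 ?tsemi_ge0 ?hc //.
  have -> : h^-1 * (cexp (h * lam xi) - 1) + -1 * lam xi =
      h^-1 * (cexp (h * lam xi) - 1 - h * lam xi) by field.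
  rewrite rnormM rnormV ler_wpM2l ?invr_ge0 ?rnorm_ge0 //.
  apply: le_trans (rnorm_cexp_sub1_sub _) _.
  rewrite ler_pM ?mulr_ge0 ?expR_ge0 ?exprn_ge0 ?rnorm_ge0 //.
    by rewrite ler_pM2l // ler_expR.
  by rewrite !expr2 ler_pM ?rnorm_ge0.
have sf' := smooth_on_pderiv j sf.
have snu : smooth_on setT (fun eta => nu j eta *: f eta).
  by apply: smooth_on_mult sf => d; exact: mult_nu.
have [c1 hc1] := cexp_sub1_small js cK snu al; have [c2 hc2] := ih _ sf' al.
exists (c1 + c2) => h xi h0 h1 Kxi; rewrite foldr_rcons.
rewrite (pderivs_list_ext openT (g := fun eta =>
    1 *: ((cexp (h * lam eta) - 1) *: (nu j eta *: f eta)) +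
    (h^-1 * (cexp (h * lam eta) - 1) + -1 * lam eta) *: pderiv j f eta)) //;
    last first.
  move=> eta _.
  have d1 := sderiv_lin 1 (sderiv_cexp_lam h j eta) (sderiv_cst j (-1) eta).
  have d2 := sderiv_lin (-1) (sderiv_lam j eta) (sderiv_cst j 0 eta).
  have d3 : sderiv j (fun eta => h^-1 * (cexp (h * lam eta) - 1) + -1 * lam eta)
      eta (nu j eta * (cexp (h * lam eta) - 1)).
    apply: sderiv_eq (sderiv_lin h^-1 d1 d2) => [x|].
      by rewrite mul1r addr0.
    rewrite mul1r !addr0 mulrBr mulr1 mulN1r -mulrA mulKf //.
  rewrite (pderiv_scale hU sf I d3) scale1r; congr (_ + _).
  by rewrite !scalerA mulrC.
rewrite (pderivs_list_linS hU openT) //; last 2 first.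
- by apply: smooth_on_mult snu => d; exact: mult_cexp_lam_sub1.
- by apply: smooth_on_mult sf' => d; exact: mult_quotient.
rewrite scale1r (le_trans (tsemiD hU _ _ _)) // mulrDl lerD ?hc2 //.
exact: hc1.
Qed.

(** The complex derivative at [z] is [lam] times the symbol at [z]. By the exponential law the error
    of the quotient is the coefficient of [quotient_small] applied to that same symbol. *)
Lemma holomorphic_gauge_symbol rho : smooth_on setT rho ->
  holomorphic_on (@symb_seminorm R n A U) (smooth_on setT) setT
    (gauge_symbol rho).
Proof.
move=> srho; split=> [z _|z _]; first exact: smooth_gauge_symbol.
have srz := smooth_gauge_symbol z srho.
exists (fun eta => lam eta *: gauge_symbol rho z eta).
  by apply: smooth_on_mult srz => d; exact: mult_lam.
case=> [[[K cK] al] beta].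
have [c hc] := quotient_small (multilist (enum 'I_n) beta) cK srz al.
have h0 : (fun h : C => `|c| * rnorm h) @ 0^' --> (0 : R).
  apply/cvgrPdist_lt => e e0; near=> h.
  rewrite sub0r normrN ger0_norm ?mulr_ge0 ?rnorm_ge0 //.
  (* Adding 1 avoids a division by zero. *)
  have hh : rnorm h < e / (`|c| + 1).
    rewrite -rc_lt -rnormE; near: h; apply: nbhs_dnbhs.
    have de : 0 < rc (e / (`|c| + 1)) :> C.
      by rewrite -rc0 rc_lt divr_gt0 // ltr_wpDl.
    exists (rc (e / (`|c| + 1))) => // h /=.
    by rewrite sub0r normrN.
  move: hh; rewrite ltr_pdivlMr ?ltr_wpDl //; apply: le_lt_trans.
  by rewrite mulrC ler_wpM2l ?rnorm_ge0 // lerDl.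
apply: (squeeze_cvgr (f := fun=> 0) (h := fun h : C => `|c| * rnorm h)) => //;
  last exact: cvg_cst.
near=> h.
have hn0 : h != 0 by near: h; exact: nbhs_dnbhs_neq.
have h1 : rnorm h <= 1.
  apply: ltW; rewrite -rc_lt -rnormE; near: h; apply: nbhs_dnbhs.
  by exists 1 => //= h /=; rewrite sub0r normrN.
rewrite /symb_seminorm /=; set S := [set _ | _ in K].
have Sub x : S x -> 0 <= x <= `|c| * rnorm h.
  case=> xi Kxi <-; rewrite tsemi_ge0 /=.
  have := hc h xi hn0 h1 Kxi; rewrite -pderivs_multilist => hc'.
  apply: le_trans (le_trans hc' _); last by rewrite ler_wpM2r ?rnorm_ge0 ?ler_norm.
  rewrite le_eqVlt; apply/orP; left; apply/eqP; congr (p al (pderivs beta _ xi)).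
  apply/funext => eta; rewrite !fctE /gauge_symbol.
  rewrite mulrDl cexpD -scalerBl !scalerA -scalerBl; congr (_ *: _).
  by ring.
(* [K] may be empty, in which case the supremum is 0 by convention. *)
have [->|/set0P[x Sx]] := eqVneq S set0.
  by rewrite sup0 lexx mulr_ge0 ?rnorm_ge0.
have uS : ubound S (`|c| * rnorm h) by move=> y /Sub/andP[].
apply/andP; split; last by apply: ge_sup => //; exists x.
have /andP[x0 _] := Sub _ Sx; apply: le_trans x0 _.
by apply: ub_le_sup => //; exists (`|c| * rnorm h).
Unshelve. all: by end_near.
Qed.

End HolomorphicFamily.

(** * The homogeneous terms and remainders of the gauged symbol *)

Section HomogeneousTerms.
Variables (R : realType) (n : nat).
Local Notation C := (cplx R).
Variables (A : cstarAlgType C) (theta : 'M[R]_n) (U : 'I_n -> A).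
Hypothesis hU : is_nctorus theta U.
Local Notation E := (smooth_torus U).
Local Notation symb := ('rV[R]_n -> E).
Local Notation V0 := (@punctured R n).
Implicit Types (rho : symb) (rhoj : nat -> symb) (xi : 'rV[R]_n).

Definition gauge_homogeneous rho (z : C) : symb :=
  fun eta => cexp (z * loglam id eta) *: rho eta.

Lemma smooth_gauge_homogeneous rho z : smooth_on V0 rho ->
  smooth_on V0 (gauge_homogeneous rho z).
Proof.
apply: smooth_on_mult => d.
apply: (mult_cexp_loglam (tau' := fun=> 1) hU (@punctured_open R n)).
- by move=> xi; exact: ssq_gt0.
- by move=> e; exact: (mult_cst hU (@punctured_open R n)).
Qed.

Lemma ssqZ (t : R) xi : ssq (t *: xi) = t ^+ 2 * ssq xi.
Proof.
by rewrite /ssq mulr_sumr; apply: eq_bigr => j _; rewrite mxE exprMn.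
Qed.

Lemma homsymb_gauge_homogeneous rho (q z : C) : homsymb q rho ->
  homsymb (z + q) (gauge_homogeneous rho z).
Proof.
case=> srho hrho; split=> [|t xi t0 xi0]; first exact: smooth_gauge_homogeneous.
rewrite /gauge_homogeneous hrho // !scalerA; congr (_ *: _).
have -> : loglam id (t *: xi) = rc (ln t) + loglam id xi.
  rewrite /loglam /= ssqZ -rcD lnM ?posrE ?exprn_gt0 ?ssq_gt0 // lnXn //.
  by congr rc; rewrite -[_ *+ 2]mulr_natr; field.
rewrite !cpowE !mulrDr mulrDl !cexpD; ring.
Qed.

Lemma gauge_symbolE rho z xi : 2^-1 < ssq xi ->
  gauge_symbol rho z xi = gauge_homogeneous rho z xi.
Proof.
by move=> h; rewrite /gauge_symbol /gauge_homogeneous /loglam smooth_sqrE.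
Qed.

Lemma smooth_on_sum N rhoj rho : smooth_on V0 rho ->
  (forall j, smooth_on V0 (rhoj j)) ->
  smooth_on V0 (fun eta => rho eta - \sum_(j < N) rhoj j eta).
Proof.
move=> srho srhoj; elim: N => [|N ih].
  by apply: (smooth_on_ext (@punctured_open R n)) srho => eta _;
    rewrite big_ord0 subr0.
have := smooth_on_lin hU (@punctured_open R n) (-1) (srhoj N) ih.
apply: (smooth_on_ext (@punctured_open R n)) => eta _.
by rewrite big_ord_recr /= opprD scaleN1r addrC addrA.
Qed.

(** The remainder of [rho] is smooth only off the origin and is estimated there with the weight
    [|xi|^z]. Uniformity for [rnorm z <= M] serves both a single [z] and compact sets. *)
Lemma remainder_bound_gauge (q : C) rho rhoj : smooth_on setT rho ->
  (forall j, homsymb (q - j%:R) (rhoj j)) ->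
  (forall N alpha beta, exists c, forall xi, 1 <= enorm xi ->
     remainder_bound q N alpha beta rho rhoj c xi) ->
  forall N (M : R) alpha beta, exists c, forall (z : C) xi,
    rnorm z <= M -> 1 <= enorm xi ->
    remainder_bound (z + q) N alpha beta (gauge_symbol rho z)
      (fun j => gauge_homogeneous (rhoj j) z) c xi.
Proof.
move=> srho hrhoj bnd N M al beta.
pose rem eta := rho eta - \sum_(j < N) rhoj j eta.
have srem : smooth_on V0 rem.
  apply: smooth_on_sum => [js xi _|j]; first exact: srho.
  by case: (hrhoj j).
pose L := multilist (enum 'I_n).
have hrem : sym_bound (L beta) (re q - N%:R) rem.
  move=> js sj al'; have [beta' ->] := subseq_multilist (enum_uniq 'I_n) sj.
  have [c hc] := bnd N al' beta'; exists c => xi xi1.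
  by have := hc xi xi1; rewrite /remainder_bound pderivs_multilist size_multilist.
have [c hc] := sym_bound_cexp hU M srem hrem (subseq_refl _) al.
exists c => z xi zM xi1; have := hc z xi zM xi1.
rewrite size_multilist addrA -reD /remainder_bound -pderivs_multilist.
(* An open set containing the closed region [1 <= enorm xi], on which the smooth and the homogeneous
   weights coincide; equality of functions thus passes to derivatives, also on the unit sphere. *)
have o := @open_ssq_gt R n 2^-1.
congr (is_true (torus_seminorm al _ <= _)).
rewrite !pderivs_multilist; apply: (pderivs_list_ext o) => [eta eta2|].
  rewrite gauge_symbolE // /gauge_homogeneous -scaler_sumr -scalerBr.
  by [].
have : 1 <= ssq xi by rewrite -enorm_sqr exprn_ege1.
by apply: lt_le_trans; rewrite invf_lt1 // ltr1n.
Qed.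

Lemma compact_rnorm_bounded (K : set C) : compact K ->
  exists M : R, forall z, K z -> rnorm z <= M.
Proof.
have cont (z : C) : (fun w : C => rnorm w) @ z --> rnorm z.
  apply/(@cvgrPdist_lt _ _ _ _ (nbhs_filter z)) => e e0.
  apply/nbhs_ballP; exists (rc e); first by rewrite /= -rc0 rc_lt.
  move=> w; rewrite -ball_normE /ball_ /= rnormE rc_lt; apply: le_lt_trans.
  rewrite ler_norml lerNl opprB !lerBlDr -{1}(rnormN (z - w)) opprB.
  by apply/andP; split; rewrite (le_trans _ (rnormD _ _)) // subrK.
move=> cK; have := continuous_compact (continuous_subspaceT (A := K) cont) cK.
move=> /compact_bounded[M [_ hM]]; exists (M + 1) => z Kz.
apply: le_trans (ler_norm _) _.
by apply: (hM (M + 1)); [rewrite ltrDl|exists z].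
Qed.

End HomogeneousTerms.

Theorem proposition6p38 (R : realType) (n : nat) (hn : (2 <= n)%N)
    (theta : 'M[R]_n) (htheta : theta^T = - theta)
    (A : cstarAlgType (cplx R)) (U : 'I_n -> A) (hU : is_nctorus theta U)
    (q : cplx R) (P : smooth_torus U -> smooth_torus U) (hP : Psi q P) :
  exists Pz : cplx R -> smooth_torus U -> smooth_torus U,
    holomorphic_family setT (fun z => z + q) Pz /\ Pz 0 = P.
Proof.
case: hP => rho [srho [rhoj [hrhoj bnd]]] ->.
have gbnd := remainder_bound_gauge hU srho hrhoj bnd.
exists (fun z => psido (gauge_symbol rho z)); split; last first.
  (* At [z = 0] the weight is 1 everywhere, including near the origin, so the symbol is [rho]
     itself. *)
  congr psido; apply/funext => eta.
  by rewrite /gauge_symbol mul0r cexp0 scale1r.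
have hom j z : homsymb (z + q - j%:R) (gauge_homogeneous (rhoj j) z).
  by rewrite -addrA; exact: (homsymb_gauge_homogeneous hU).
split; first exact: openT.
exists (gauge_symbol rho); split=> //.
- split=> z _; first by apply: derivableD.
  split; first exact: (smooth_gauge_symbol hU).
  exists (fun j => gauge_homogeneous (rhoj j) z); split=> // N al beta.
  have [c hc] := gbnd N (rnorm z) al beta.
  by exists c => xi; exact: hc.
- exact: (holomorphic_gauge_symbol hU).
exists (fun j z => gauge_homogeneous (rhoj j) z); split=> // N K al beta cK _.
have [M hM] := compact_rnorm_bounded cK.
have [c hc] := gbnd N M al beta.
by exists c => z xi Kz; apply: hc; exact: hM.
Qed.
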